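(* Let $p$ be a prime, let $K/\mathbb Q_p$ be a finite extension with ring of integers $\mathcal O_K$ and maximal ideal $\mathfrak m_K$, and fix an algebraic closure $\overline K$ of $K$. Let $f\in\mathcal O_K[X]$ be monic of degree at least $2$ with $f(X)\equiv X^{p^a}\pmod{\mathfrak m_K}$ for some integer $a\geq 1$. Let $t_0\in\mathcal O_K$ and let $(t_n)_{n\geq 0}$ be any sequence in $\overline K$ with $f(t_{n+1})=t_n$ for all $n\geq 0$. Put $K_\infty:=\bigcup_{n\geq 0}K(t_n)$. Then either $K_\infty=K$ or $K_\infty/K$ is deeply ramified.
   Context: The congruence is coefficientwise, i.e. $f(X)-X^{p^a}\in\mathfrak m_K\mathcal O_K[X]$; it implies $f'(X)\in\mathfrak m_K\mathcal O_K[X]$. The valuation $v_K$ on $\overline K$ is normalized by $v_K(\pi_K)=1$ for a uniformizer $\pi_K$ of $K$, and $\mathfrak D_{F/K}$ denotes the different of a finite extension $F/K$, whose valuation is that of any generator. Deep ramification is the notion of Coates and Greenberg, used through the standard criterion: an algebraic extension $L/K$ is deeply ramified if and only if the valuations $v_K(\mathfrak D_{F/K})$, with $F$ ranging over the finite subextensions of $L/K$ (equivalently, over any cofinal tower of finite subextensions), are unbounded. *)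

(* Defs.v *)
From HB Require Import structures.
From mathcomp Require Import all_boot all_order all_algebra all_field.
From mathcomp Require Import classical_sets constructive_ereal.

Set Implicit Arguments.
Unset Strict Implicit.
Unset Printing Implicit Defensive.

Import Order.TTheory GRing.Theory Num.Theory.

Local Open Scope classical_set_scope.
Local Open Scope ring_scope.

(* Rational values suffice: the normalized valuation of an algebraic closure   *)
(* of a p-adic field has value group rat.                                      *)
Record is_valuation (F : fieldType) (v : F -> \bar rat) : Prop := IsValuation {
  valuation_eq0 : forall x, v x = +oo%E <-> x = 0;
  valuation_neqNy : forall x, v x <> -oo%E;
  valuationM : forall x y, v (x * y) = (v x + v y)%E;
  valuationD : forall x y, (Order.min (v x) (v y) <= v (x + y)%R)%E }.

Definition rat_padic_val (p : nat) (q : rat) : \bar rat :=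
  if q == 0 then +oo%E
  else ((logn p `|numq q|%N)%:R - (logn p `|denq q|%N)%:R)%:E.

(* (Qp, vp) is the completion of rat for the p-adic valuation. As for          *)
(* realType, the field is axiomatized rather than built; these properties      *)
(* determine (Qp, vp) up to a unique isomorphism.                              *)
Record is_padic_field (p : nat) (Qp : fieldType) (vp : Qp -> \bar rat) : Prop :=
  IsPadicField {
  padic_valuation : is_valuation vp;
  padic_ratr : forall q : rat, vp (ratr q) = rat_padic_val p q;
  padic_dense : forall (x : Qp) (B : rat),
    exists q : rat, (B%:E < vp (x - ratr q)%R)%E;
  padic_complete : forall u : nat -> Qp,
    (forall B : rat, exists N : nat, forall m n : nat,
       (N <= m)%N -> (N <= n)%N -> (B%:E < vp (u m - u n)%R)%E) ->
    exists l : Qp, forall B : rat, exists N : nat, forall n : nat,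
       (N <= n)%N -> (B%:E < vp (u n - l)%R)%E }.

Definition is_algebraic_closure (K : fieldType) (Kbar : closedFieldType)
    (iota : {rmorphism K -> Kbar}) : Prop :=
  forall x : Kbar, algebraicOver iota x.

Definition val_ring (F : fieldType) (v : F -> \bar rat) : {pred F} :=
  [pred x | (0 <= v x)%E].

Definition val_max (F : fieldType) (v : F -> \bar rat) : {pred F} :=
  [pred x | (0 < v x)%E].

Definition is_uniformizer (F : fieldType) (v : F -> \bar rat) (pi : F) : Prop :=
  pi \in val_max v /\
  forall x, x \in val_max v -> exists2 y, y \in val_ring v & x = pi * y.

(* vK is the unique valuation of Kbar which extends the p-adic one up to a     *)
(* positive factor (the ramification index of K / Qp) and takes the value 1    *)
(* at a uniformizer of K.                                                      *)
Record is_normalized_valuation (Qp : fieldType) (vp : Qp -> \bar rat)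
    (K : fieldExtType Qp) (Kbar : closedFieldType)
    (iota : {rmorphism K -> Kbar}) (vK : Kbar -> \bar rat) : Prop :=
  IsNormalizedValuation {
  normalized_valuation : is_valuation vK;
  normalized_extends : exists2 e : rat, 0 < e &
    forall x : Qp, vK (iota x%:A) = (e%:E * vp x)%E;
  normalized_uniformizer : exists2 pi : K,
    is_uniformizer (vK \o iota) pi & vK (iota pi) = 1%:E }.

Definition field_trace (K : fieldType) (F : fieldExtType K) (x : F) : K :=
  \tr (passmx.mxof (vbasis {:F}) (vbasis {:F}) (amull x)).

(* In the next two definitions, v is a valuation of F; that of K is its        *)
(* restriction, so the valuation ring of K is {a | a%:A \in val_ring v}.       *)
Definition codifferent (K : fieldType) (F : fieldExtType K)
    (v : F -> \bar rat) : set F :=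
  [set x | forall y : F, y \in val_ring v ->
             (field_trace (x * y))%:A \in val_ring v].

Definition different (K : fieldType) (F : fieldExtType K)
    (v : F -> \bar rat) : set F :=
  [set z | forall x : F, codifferent v x -> z * x \in val_ring v].

Definition different_valuation (K : fieldType) (F : fieldExtType K)
    (v : F -> \bar rat) (d : rat) : Prop :=
  exists2 g : F,
    different v = [set g * y | y in [set` val_ring v]] & v g = d%:E.

Definition adjoin (K Kbar : fieldType) (iota : {rmorphism K -> Kbar})
    (t : Kbar) : set Kbar :=
  [set x | exists q r : {poly K},
     (map_poly iota r).[t] != 0 /\
     x = (map_poly iota q).[t] / (map_poly iota r).[t]].

(* A finite subextension of L / K is given as an abstract finite extension F   *)
(* of K with a K-embedding j : F -> Kbar whose image lies in L.                *)
Definition deeply_ramified (K Kbar : fieldType) (iota : {rmorphism K -> Kbar})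
    (vK : Kbar -> \bar rat) (L : set Kbar) : Prop :=
  forall B : rat,
    exists (F : fieldExtType K) (j : {rmorphism F -> Kbar}) (d : rat),
      [/\ forall a : K, j a%:A = iota a,
          range j `<=` L,
          different_valuation (vK \o j) d
        & B < d].

(* Main.v *)
Require Import Defs.
From HB Require Import structures.
From mathcomp Require Import all_boot all_order all_algebra all_field.
From mathcomp Require Import boolp classical_sets constructive_ereal.
From mathcomp Require Import zify ring lra.

Set Implicit Arguments.
Unset Strict Implicit.
Unset Printing Implicit Defensive.

Import Order.TTheory GRing.Theory Num.Theory.

Local Open Scope classical_set_scope.
Local Open Scope ring_scope.

(* Write q = p^a. Modulo the maximal ideal f is the q-th power map, and the   *)
(* residue field of K is finite, so every t_n has the residue of some s_n in  *)
(* K; put x_n = t_n - s_n. Then v(x_n) > 0 and v(x_(n+1)^q - x_n) >= 1.       *)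
(*                                                                            *)
(* If v(x_n) >= 1 for all n, then t_n = f^m(t_(n+m)) is the limit of the      *)
(* f^m(s_(n+m)), since f contracts; thus t_n is in K. Otherwise               *)
(* v(x_(n+m)) = v(x_n) / q^m as soon as v(x_n) < 1. As K(t_n) / K has degree  *)
(* at most q^n, for a suitable fixed s the value v(x_(n+s)) is too small to   *)
(* be taken on K(t_n). But the conjugates of t_(n+s) over K(t_n) differ by    *)
(* elements of valuation at least 1/q^s; if the trace over K(t_n) of some     *)
(* integer c of K(t_(n+s)) had a small valuation, then Tr(c x_(n+s)) / Tr(c)  *)
(* would approximate x_(n+s), as in the theorem of Ax, Sen and Tate, and thus *)
(* have the same value. So the traces from K(t_(n+s)) to K(t_n) of integers   *)
(* have valuations bounded below by a positive constant, and the valuation of *)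
(* the different grows at least by a constant from level n to level n + s.    *)

(** * Valuations *)

(** The different is bounded below by exhibiting elements of the codifferent of very negative
    valuation. Suppose some gap has valuation less than 1, and let w be the gap at the fixed level
    [n1], of valuation [mu > 0]. Over every climb of [n0] levels, relative traces of integers have
    valuation at least [eps >= mu] ([partial_trace_ge]). By induction, an element of [level i] of
    valuation at least -i mu has an integral trace to [K] ([trace_ge0]). Hence w^(-i) is in the
    codifferent, and the different has valuation at least i mu ([deeply_ramified_of_large_gap]). The
    other case is [rational_of_small_gaps], which rests on [phi_contract].

    Conjugation is expressed by polynomials: an element of K(z) is q(z), and its conjugates are the
    q(r) with r a root of the minimal polynomial of z. In this language [trace_norm_conjugates]
    computes traces and norms, [conj_partial_sum] gives relative traces, [conj_vge] shows that
    conjugates have equal valuations, and [conj_vval_int] bounds the denominators of the valuations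
    on K(z) by the degree. *)

Definition vge (F : fieldType) (v : F -> \bar rat) (c : rat) (x : F) : bool :=
  (c%:E <= v x)%E.

(* At [x = 0] this is the junk value [fine +oo = 0]. *)
Definition vval (F : fieldType) (v : F -> \bar rat) (x : F) : rat := fine (v x).

Section Valuation.

Variables (F : fieldType) (v : F -> \bar rat).
Hypothesis vP : is_valuation v.

Lemma valE x : x != 0 -> v x = (vval v x)%:E.
Proof.
move=> nz_x; rewrite /vval; case E: (v x) => [r||] //.
  by case/eqP: nz_x; apply/(valuation_eq0 vP).
by case: (valuation_neqNy vP E).
Qed.

Lemma val0 : v 0 = +oo%E.
Proof. exact/(valuation_eq0 vP). Qed.

Lemma vgeE c x : x != 0 -> vge v c x = (c <= vval v x).
Proof. by move=> /valE E; rewrite /vge E lee_fin. Qed.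

Lemma vge0 c : vge v c 0.
Proof. by rewrite /vge val0 leey. Qed.

Lemma vge_trans c d x : d <= c -> vge v c x -> vge v d x.
Proof. by move=> le_dc; apply: le_trans; rewrite lee_fin. Qed.

Lemma vvalM x y : x != 0 -> y != 0 -> vval v (x * y) = vval v x + vval v y.
Proof.
by move=> nz_x nz_y; rewrite {1}/vval (valuationM vP) (valE nz_x) (valE nz_y).
Qed.

Lemma vval1 : vval v 1 = 0.
Proof.
have := vvalM (oner_neq0 F) (oner_neq0 F); rewrite mulr1; lra.
Qed.

Lemma vvalX x n : x != 0 -> vval v (x ^+ n) = n%:R * vval v x.
Proof.
move=> nz_x; elim: n => [|n IHn]; first by rewrite vval1 mul0r.
by rewrite exprS vvalM ?expf_neq0 // IHn -natr1 mulrDl mul1r addrC.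
Qed.

Lemma vvalV x : x != 0 -> vval v x^-1 = - vval v x.
Proof.
move=> nz_x; have := vvalM nz_x (invr_neq0 nz_x).
by rewrite divff // vval1; lra.
Qed.

Lemma vvalN1 : vval v (-1) = 0.
Proof.
have := @vvalX (-1) 2; rewrite sqrrN expr1n vval1 oppr_eq0 oner_eq0.
by move=> /(_ isT); lra.
Qed.

Lemma vvalN x : vval v (- x) = vval v x.
Proof.
have [->|nz_x] := eqVneq x 0; first by rewrite oppr0.
by rewrite -mulN1r vvalM ?oppr_eq0 ?oner_eq0 // vvalN1 add0r.
Qed.

Lemma vge1 : vge v 0 1.
Proof. by rewrite vgeE ?oner_eq0 // vval1. Qed.

Lemma vgeM c d x y : vge v c x -> vge v d y -> vge v (c + d) (x * y).
Proof.
by move=> cx dy; rewrite /vge (valuationM vP) EFinD leeD.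
Qed.

Lemma vgeD c x y : vge v c x -> vge v c y -> vge v c (x + y).
Proof.
move=> cx cy; apply: le_trans (valuationD vP x y).
by rewrite le_min; apply/andP.
Qed.

Lemma vgeN c x : vge v c (- x) = vge v c x.
Proof.
have [->|nz_x] := eqVneq x 0; first by rewrite oppr0.
by rewrite !vgeE ?oppr_eq0 // vvalN.
Qed.

Lemma vgeB c x y : vge v c x -> vge v c y -> vge v c (x - y).
Proof. by move=> cx cy; rewrite vgeD ?vgeN. Qed.

Lemma vge_subC c x y : vge v c (x - y) = vge v c (y - x).
Proof. by rewrite -vgeN opprB. Qed.

Lemma vge_subtrans c y x z : vge v c (x - y) -> vge v c (y - z) -> vge v c (x - z).
Proof. by move=> h1 h2; rewrite -(subrK y x) -addrA vgeD. Qed.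

Lemma vge_sum c (I : Type) (r : seq I) (P : pred I) (E : I -> F) :
  (forall i, P i -> vge v c (E i)) -> vge v c (\sum_(i <- r | P i) E i).
Proof.
move=> cE; apply: (big_ind (fun x => vge v c x)) => //; first exact: vge0.
by move=> x y; apply: vgeD.
Qed.

Lemma vgeM0 c x y : vge v 0 x -> vge v c y -> vge v c (x * y).
Proof. by move=> h1 h2; rewrite -[c]add0r vgeM. Qed.

Lemma vge_nat n : vge v 0 n%:R.
Proof.
elim: n => [|n IHn]; first exact: vge0.
by rewrite -natr1 vgeD // vge1.
Qed.

Lemma vge_muln c x n : vge v c x -> vge v c (x *+ n).
Proof. by move=> cx; rewrite -mulr_natl vgeM0 // vge_nat. Qed.

Lemma vgeX c x n : vge v c x -> vge v (n%:R * c) (x ^+ n).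
Proof.
move=> cx; elim: n => [|n IHn]; first by rewrite mul0r vge1.
by rewrite exprS -nat1r mulrDl mul1r vgeM.
Qed.

Lemma vgeX0 x n : vge v 0 x -> vge v 0 (x ^+ n).
Proof. by move=> /(vgeX n); rewrite mulr0. Qed.

Lemma vge_root c x n : (0 < n)%N -> vge v (n%:R * c) (x ^+ n) -> vge v c x.
Proof.
move=> n_gt0; have [->|nz_x] := eqVneq x 0; first by rewrite vge0.
by rewrite !vgeE ?expf_neq0 // vvalX // ler_pM2l // ltr0n.
Qed.

Lemma vge_eq0 x : (forall c : nat, vge v c%:R x) -> x = 0.
Proof.
move=> cx; apply/eqP/negPn/negP => nz_x.
have := cx (Num.bound `|vval v x|); rewrite vgeE //.
have := archi_boundP (normr_ge0 (vval v x)); have := ler_norm (vval v x); lra.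
Qed.

(** The ultrametric inequality is used both ways: on y = x + (y - x), and on x = y - (y - x), which
    excludes a larger valuation of y. *)
Lemma vval_close c x y : x != 0 -> vge v c (y - x) -> vval v x < c ->
  y != 0 /\ vval v y = vval v x.
Proof.
move=> nz_x cyx lt_xc.
have nz_y: y != 0.
  by apply: contraTneq cyx => ->; rewrite sub0r vgeN vgeE // -ltNge.
split=> //; apply/eqP; rewrite eq_le; apply/andP; split; last first.
  rewrite -vgeE // -(subrK x y) vgeD //; last by rewrite vgeE.
  by apply: vge_trans cyx; apply: ltW.
rewrite leNgt; apply/negP => lt_xy.
have: vge v (Num.min c (vval v y)) x.
  rewrite -[x](subKr y) vgeB //.
    by apply: (@vge_trans (vval v y)); rewrite ?vgeE // ge_min lexx orbT.
  by apply: vge_trans cyx; rewrite ge_min lexx.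
by rewrite vgeE // leNgt lt_min lt_xc lt_xy.
Qed.

End Valuation.

(** * Norm equivalence over a complete field *)

(** [K] is given no valuation of its own: completeness refers to the restriction of [v] along [i],
    and [F] itself need not be complete. *)
Definition vcomplete (K F : fieldType) (v : F -> \bar rat)
    (i : {rmorphism K -> F}) : Prop :=
  forall u : nat -> K,
    (forall c : rat, exists N : nat, forall m n : nat,
       (N <= m)%N -> (N <= n)%N -> vge v c (i (u m - u n))) ->
    exists l : K, forall c : rat, exists N : nat, forall n : nat,
       (N <= n)%N -> vge v c (i (u n - l)).

Section NormEquivalence.

Variables (F : fieldType) (v : F -> \bar rat).
Hypothesis vP : is_valuation v.

Lemma vge_ex x : exists c, vge v c x.
Proof.
have [->|nz_x] := eqVneq x 0; first by exists 0; rewrite vge0.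
by exists (vval v x); rewrite vgeE.
Qed.

Lemma vge_ex_fam k (e : 'I_k -> F) : exists c, forall j, vge v c (e j).
Proof.
elim: k e => [|k IHk] e; first by exists 0 => -[].
have [c ce] := IHk (e \o lift ord0); have [d de] := vge_ex (e ord0).
exists (Num.min c d) => j; case: (unliftP ord0 j) => [j'|] ->.
  by apply: vge_trans (ce j'); rewrite ge_min lexx.
by apply: vge_trans de; rewrite ge_min lexx orbT.
Qed.

Variables (K : fieldType) (i : {rmorphism K -> F}).
Hypothesis K_complete : vcomplete v i.

Lemma eventually_fam k (P : 'I_k -> nat -> Prop) :
  (forall j, exists N, forall n, (N <= n)%N -> P j n) ->
  exists N, forall j n, (N <= n)%N -> P j n.
Proof.
move=> /choice[N NP]; exists (\max_j N j) => j n le_n; apply: NP.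
exact: leq_trans (leq_bigmax j) le_n.
Qed.

(* Coordinates with respect to a free family over a complete field are        *)
(* bounded: otherwise some e_0 would be a limit of combinations of the other  *)
(* e_j, hence such a combination.                                             *)
Lemma coord_bounded k (e : 'I_k -> F) :
  (forall a : 'I_k -> K, \sum_j i (a j) * e j = 0 -> forall j, a j = 0) ->
  exists C : rat, forall (a : 'I_k -> K) c, vge v c (\sum_j i (a j) * e j) ->
    forall j, vge v (c - C) (i (a j)).
Proof.
elim: k e => [|k IHk] e free_e; first by exists 0 => a c _ [].
pose e' j := e (lift ord0 j).
pose ext b (a : 'I_k -> K) j := oapp a b (unlift ord0 j).
have extE b a : \sum_j i (ext b a j) * e j = i b * e ord0 + \sum_j i (a j) * e' j.
  rewrite big_ord_recl {1}/ext unlift_none /=; congr (_ + _).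
  by apply: eq_bigr => j _; rewrite /ext liftK.
have free_e' a : \sum_j i (a j) * e' j = 0 -> forall j, a j = 0.
  move=> a0 j; have := @free_e (ext 0 a); rewrite extE rmorph0 mul0r add0r.
  by move=> /(_ a0 (lift ord0 j)); rewrite /ext liftK.
have [C boundC] := IHk e' free_e'.
have [E eE] := vge_ex_fam e'; have [E0 e0E] := vge_ex (e ord0).
(* Combinations approximating [- e ord0] to precision n have Cauchy coordinates by the induction
   hypothesis; the limits give a relation in which [e ord0] has coefficient 1. *)
have [B boundB]: exists B : rat, forall a,
    ~ vge v B (e ord0 + \sum_j i (a j) * e' j).
  apply: contrapT => /forallNP noB.
  have /choice[u uP] (n : nat) : exists a : 'I_k -> K,
      vge v n%:R (e ord0 + \sum_j i (a j) * e' j).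
    by apply: contrapT => /forallNP h; apply: (noB n%:R).
  have u_cauchy c N m n : c + C <= N%:R -> (N <= m)%N -> (N <= n)%N ->
      forall j, vge v c (i (u m j - u n j)).
    move=> leN Nm Nn j; rewrite -[c](addrK C).
    apply: (boundC (fun j => u m j - u n j)).
    have ->: \sum_j i (u m j - u n j) * e' j =
       (e ord0 + \sum_j i (u m j) * e' j) - (e ord0 + \sum_j i (u n j) * e' j).
      rewrite opprD addrACA subrr add0r -sumrB; apply: eq_bigr => l _.
      by rewrite rmorphB mulrBl.
    apply: vgeB => //; [apply: vge_trans (uP m) | apply: vge_trans (uP n)];
      by apply: le_trans leN _; rewrite ler_nat.
  have bnd (c : rat) : c <= (Num.bound `|c|)%:R.
    by apply: ltW; apply: le_lt_trans (ler_norm c) _; apply: archi_boundP.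
  have /choice[l lP] j : exists l : K, forall c : rat, exists N : nat,
      forall n, (N <= n)%N -> vge v c (i (u n j - l)).
    apply: K_complete => c; exists (Num.bound `|c + C|) => m n Nm Nn.
    exact: u_cauchy (bnd _) Nm Nn j.
  have: e ord0 + \sum_j i (l j) * e' j = 0.
    apply: (vge_eq0 vP) => c.
    have [N NP] := eventually_fam (fun j => lP j (c%:R - E)).
    pose n := maxn N c.
    have ->: e ord0 + \sum_j i (l j) * e' j =
      (e ord0 + \sum_j i (u n j) * e' j) - \sum_j i (u n j - l j) * e' j.
      rewrite -addrA; congr (_ + _); rewrite -sumrB; apply: eq_bigr => j _.
      by rewrite rmorphB -mulrBl opprB addrC subrK.
    apply: vgeB => //.
      by apply: vge_trans (uP n); rewrite ler_nat leq_maxr.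
    apply: vge_sum => // j _; rewrite -[c%:R](subrK E) vgeM //.
    by apply: NP; rewrite leq_maxl.
  have := @free_e (ext 1 l); rewrite extE rmorph1 mul1r => h /h /(_ ord0).
  by rewrite /ext unlift_none => /eqP; rewrite oner_eq0.
(* Division by [a ord0] makes the coefficient of [e ord0] equal to 1, so [boundB] bounds [a ord0].
   The other coordinates are bounded by the induction hypothesis once the [e ord0] term is
   subtracted. Absolute values keep the three losses from cancelling. *)
exists (`|B| + `|C| + `|E0|) => a c.
rewrite big_ord_recl; set h := _ + _ => ch.
have b0 := normr_ge0 B; have b1 := ler_norm B.
have c0 := normr_ge0 C; have c1 := ler_norm C.
have e0 := normr_ge0 E0; have e1 := ler_norm (- E0); rewrite normrN in e1.
have a0B: vge v (c - B) (i (a ord0)).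
  have [->|nz_a] := eqVneq (a ord0) 0; first by rewrite rmorph0 vge0.
  have nz_ia: i (a ord0) != 0 by rewrite fmorph_eq0.
  rewrite vgeE // leNgt; apply/negP => lt_a.
  apply: (boundB (fun j => a (lift ord0 j) / a ord0)).
  have ->: e ord0 + \sum_j i (a (lift ord0 j) / a ord0) * e' j = h / i (a ord0).
    rewrite mulrDl mulrAC divff // mul1r; congr (_ + _).
    rewrite mulr_suml; apply: eq_bigr => j _.
    by rewrite fmorph_div mulrAC.
  have: vge v (c + vval v (i (a ord0))^-1) (h / i (a ord0)).
    by rewrite vgeM // vgeE ?invr_eq0.
  by apply: vge_trans; rewrite vvalV //; lra.
move=> j; case: (unliftP ord0 j) => [j'|] ->; last by apply: vge_trans a0B; lra.
apply: (@vge_trans _ _ ((c - `|B| - `|E0|) - C)); first lra.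
apply: (boundC (a \o lift ord0)).
have ->: \sum_j i ((a \o lift ord0) j) * e' j = h - i (a ord0) * e ord0.
  by rewrite /h addrC addKr.
apply: vgeB => //; first by apply: vge_trans ch; lra.
apply: (@vge_trans _ _ ((c - B) + E0)); first lra.
by rewrite vgeM.
Qed.

End NormEquivalence.

(** By [coord_bounded] the coordinates of a Cauchy sequence in a basis are Cauchy; their limits are
    the coordinates of its limit. *)
Lemma vcomplete_ext (K0 : fieldType) (K : fieldExtType K0) (F : fieldType)
    (v : F -> \bar rat) (vP : is_valuation v) (i : {rmorphism K -> F}) :
  vcomplete v (i \o in_alg K) -> vcomplete v i.
Proof.
move=> K0_complete u u_cauchy.
pose b := vbasis {:K}; pose e (j : 'I_(\dim {:K})) := i b`_j.
have b_basis := vbasisP {:K}.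
have sumE (a : 'I_(\dim {:K}) -> K0) :
    \sum_j (i \o in_alg K) (a j) * e j = i (\sum_j a j *: b`_j).
  by rewrite rmorph_sum; apply: eq_bigr => j _; rewrite /= -rmorphM mulr_algl.
have free_e (a : 'I_(\dim {:K}) -> K0) :
    \sum_j (i \o in_alg K) (a j) * e j = 0 -> forall j, a j = 0.
  rewrite sumE => /eqP; rewrite fmorph_eq0 => /eqP a0.
  by apply: (freeP _ _) a0; exact: basis_free b_basis.
have [C boundC] := coord_bounded vP K0_complete free_e.
have /choice[l lP] j : exists l : K0, forall c : rat, exists N : nat,
    forall n, (N <= n)%N -> vge v c ((i \o in_alg K) (coord b j (u n) - l)).
  apply: K0_complete => c; have [N NP] := u_cauchy (c + C).
  exists N => m n Nm Nn; rewrite -linearB -[c](addrK C).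
  apply: (boundC (fun j => coord b j (u m - u n))).
  by rewrite sumE -(coord_basis b_basis (memvf (u m - u n))) NP.
have [E eE] := vge_ex_fam vP e.
exists (\sum_j l j *: b`_j) => c.
have [N NP] := eventually_fam (fun j => lP j (c - E)).
exists N => n Nn.
rewrite {1}(coord_basis b_basis (memvf (u n))) -sumrB rmorph_sum.
apply: (vge_sum vP) => j _; rewrite -scalerBl -[c](subrK E) -mulr_algl rmorphM.
by apply: (vgeM vP) (eE j); exact: NP.
Qed.

(** * Conjugates, traces and norms *)

Section Conjugates.

Variables (K L : fieldType) (iota : {rmorphism K -> L}).

(** [P] is the minimal polynomial of [z], assumed separable ([conj_uniq]), and [R] lists its roots,
    so that [size R] is the degree of K(z) over [K]. *)
Record is_conjugates (z : L) (P : {poly K}) (R : seq L) : Prop := IsConjugates {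
  conj_monic : P \is monic;
  conj_irr : irreducible_poly P;
  conj_prod : map_poly iota P = \prod_(r <- R) ('X - r%:P);
  conj_uniq : uniq R;
  conj_mem : z \in R }.

Lemma irreducible_root_dvdp (P q : {poly K}) (z : L) :
  irreducible_poly P -> root (map_poly iota P) z ->
  root (map_poly iota q) z -> P %| q.
Proof.
move=> irrP Pz qz; apply: contraTT qz; rewrite -irreducible_poly_coprime //.
by rewrite -(coprimep_map iota) => /coprimep_root /(_ Pz).
Qed.

Lemma dvdp_map_root (p q : {poly K}) (r : L) :
  p %| q -> root (map_poly iota p) r -> (map_poly iota q).[r] = 0.
Proof.
by move=> /dvdpP[u ->] /eqP pr0; rewrite rmorphM hornerM pr0 mulr0.
Qed.

Section Given.

Variables (z : L) (P : {poly K}) (R : seq L).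
Hypothesis zPR : is_conjugates z P R.

Lemma conj_root r : r \in R -> root (map_poly iota P) r.
Proof. by rewrite (conj_prod zPR) root_prod_XsubC. Qed.

Lemma conj_size : size P = (size R).+1.
Proof. by rewrite -(size_map_poly iota) (conj_prod zPR) size_prod_XsubC. Qed.

(** This plays the part of the [K]-isomorphism from K(r) to K(s) sending r to s: polynomial
    relations pass from one conjugate to another. *)
Lemma conj_horner0 (q : {poly K}) r s : r \in R -> s \in R ->
  (map_poly iota q).[r] = 0 -> (map_poly iota q).[s] = 0.
Proof.
move=> Rr Rs /eqP qr; apply: (@dvdp_map_root P) (conj_root Rs).
exact: irreducible_root_dvdp (conj_irr zPR) (conj_root Rr) qr.
Qed.

Lemma conj_horner_eq (p q : {poly K}) r s : r \in R -> s \in R ->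
  (map_poly iota p).[r] = (map_poly iota q).[r] ->
  (map_poly iota p).[s] = (map_poly iota q).[s].
Proof.
move=> Rr Rs /eqP; rewrite -subr_eq0 -hornerN -hornerD -rmorphB => /eqP h.
have := conj_horner0 Rr Rs h.
by rewrite rmorphB hornerD hornerN => /eqP; rewrite subr_eq0 => /eqP.
Qed.

End Given.

End Conjugates.

(** A monic polynomial of least degree vanishing at [z] is irreducible. In characteristic 0 its
    derivative is nonzero and of smaller degree, hence coprime to it, so the roots are distinct. *)
Lemma conjugates_exist (K : fieldType) (L : closedFieldType)
    (iota : {rmorphism K -> L}) (z : L) :
  (forall n, n.+1%:R != 0 :> K) -> algebraicOver iota z ->
  exists P R, is_conjugates iota z P R.
Proof.
move=> char0 [p nz_p pz].
have exP: exists n, `[< exists q : {poly K},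
    [/\ q \is monic, size q = n & root (map_poly iota q) z] >].
  exists (size p); apply/asboolP; exists ((lead_coef p)^-1 *: p); split.
  - by rewrite monicE lead_coefZ mulVf ?lead_coef_eq0.
  - by rewrite size_scale // invr_eq0 lead_coef_eq0.
  by rewrite map_polyZ rootE hornerZ (rootP pz) mulr0.
case: (ex_minnP exP) => n /asboolP[P [monP szP Pz]] minP.
have irrP: irreducible_poly P.
  apply/(subfx_irreducibleP Pz (monic_neq0 monP)) => q qz nz_q.
  rewrite szP; apply: minP; apply/asboolP; exists ((lead_coef q)^-1 *: q); split.
  - by rewrite monicE lead_coefZ mulVf ?lead_coef_eq0.
  - by rewrite size_scale // invr_eq0 lead_coef_eq0.
  by rewrite map_polyZ rootE hornerZ (rootP qz) mulr0.
have [R ER] := closed_field_poly_normal (map_poly iota P).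
have {}ER: map_poly iota P = \prod_(r <- R) ('X - r%:P).
  by rewrite ER lead_coef_map (monicP monP) rmorph1 scale1r.
exists P, R; split=> //; last by rewrite -root_prod_XsubC -ER.
rewrite -separable_prod_XsubC -ER separable_map unlock.
rewrite irreducible_poly_coprime //; apply/negP => /dvdp_leq.
have szP1 : (1 < size P)%N by case: irrP.
have nz_dP: P^`() != 0.
  apply/eqP => /(congr1 (fun q : {poly K} => q`_(size P).-2)) /eqP.
  rewrite coef_deriv coef0 -mulr_natr.
  have ->: (size P).-2.+1 = (size P).-1 by case: (size P) szP1 => [|[]].
  rewrite -lead_coefE (monicP monP) mul1r.
  by case: (size P) szP1 => [|[|k]] // _; rewrite (negPf (char0 k)).
by move=> /(_ nz_dP); rewrite leqNgt lt_size_deriv // monic_neq0.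
Qed.

Section Trace.

Variables (K L : fieldType) (iota : {rmorphism K -> L}).
Variables (z : L) (P : {poly K}) (R : seq L).
Hypothesis zPR : is_conjugates iota z P R.
Variables (F : fieldExtType K) (j : {rmorphism F -> L}) (tau : F).
Hypothesis jE : forall a : K, j a%:A = iota a.
Hypothesis j_tau : j tau = z.
Hypothesis dimF : \dim {:F} = size R.
Hypothesis genF : forall x : F, exists q, x = (map_poly (in_alg F) q).[tau].

Lemma j_horner (q : {poly K}) :
  j (map_poly (in_alg F) q).[tau] = (map_poly iota q).[z].
Proof.
rewrite -horner_map j_tau -map_poly_comp; congr (_.[_]).
by apply: eq_map_poly => a; rewrite /= jE.
Qed.

Lemma conj_eval_eq (p q : {poly K}) r : r \in R ->
  (map_poly (in_alg F) p).[tau] = (map_poly (in_alg F) q).[tau] ->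
  (map_poly iota p).[r] = (map_poly iota q).[r].
Proof.
move=> Rr /(congr1 j); rewrite !j_horner => h.
exact: (conj_horner_eq zPR (conj_mem zPR) Rr h).
Qed.

(* With b_i = beta_i(tau) the basis of F, W the matrix of the beta_i(r) and A *)
(* the matrix of the multiplication by q(tau), A W = W diag(q(r)); and W is   *)
(* invertible as it divides the Vandermonde matrix of the conjugates.         *)
Lemma trace_norm_conjugates (q : {poly K}) :
  iota (field_trace (map_poly (in_alg F) q).[tau]) =
    \sum_(r <- R) (map_poly iota q).[r]
  /\ exists N : K, iota N = \prod_(r <- R) (map_poly iota q).[r].
Proof.
set x := _.[tau]; have dimn := dimF; pose b := vbasis {:F}.
set n := \dim {:F} in dimn b.
have b_basis : basis_of fullv b := vbasisP {:F}.
have /choice[beta betaE] (i : 'I_n) :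
    exists q : {poly K}, b`_i = (map_poly (in_alg F) q).[tau] by apply: genF.
pose rt (k : 'I_n) := R`_k.
have Rrt k : rt k \in R by rewrite mem_nth // -dimn.
pose W := \matrix_(i < n, k < n) (map_poly iota (beta i)).[rt k].
pose A := passmx.mxof b b (amull x).
pose D := diag_mx (\row_(k < n) (map_poly iota q).[rt k]).
have sum_beta (c : 'I_n -> K) (y : {poly K}) k :
    \sum_i c i *: b`_i = (map_poly (in_alg F) y).[tau] ->
    \sum_i iota (c i) * (map_poly iota (beta i)).[rt k] =
      (map_poly iota y).[rt k].
  move=> Ey; transitivity (map_poly iota (\sum_i c i *: beta i)).[rt k].
    rewrite rmorph_sum /= horner_sum; apply: eq_bigr => i _.
    by rewrite map_polyZ hornerZ.
  apply: conj_eval_eq => //; rewrite -Ey rmorph_sum /= horner_sum.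
  by apply: eq_bigr => i _; rewrite betaE map_polyZ hornerZ mulr_algl.
have AW: map_mx iota A *m W = W *m D.
  apply/matrixP => i k; rewrite mul_mx_diag !mxE.
  under eq_bigr do rewrite !mxE.
  rewrite (sum_beta _ (q * beta i)); first by rewrite rmorphM hornerM mulrC.
  rewrite rmorphM hornerM -betaE -/x.
  rewrite [RHS](coord_basis b_basis (memvf (x * b`_i))).
  by apply: eq_bigr => l _; rewrite ?mxE /= passmx.vecof_delta lfunE.
have Wu: W \in unitmx.
  pose V := Vandermonde n (\row_k rt k).
  pose B := \matrix_(i < n, l < n) coord b l (tau ^+ i).
  have: V \in unitmx.
    rewrite unitmxE det_Vandermonde unitfE; apply/prodf_neq0 => i _.
    apply/prodf_neq0 => k lt_ik; rewrite !mxE subr_eq0.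
    by rewrite nth_uniq ?(conj_uniq zPR) -?dimn // gtn_eqF.
  have ->: V = map_mx iota B *m W.
    apply/matrixP => i k; rewrite !mxE; under eq_bigr do rewrite !mxE.
    rewrite (sum_beta _ 'X^i); first by rewrite map_polyXn hornerXn.
    rewrite map_polyXn hornerXn.
    by rewrite -(coord_basis b_basis (memvf (tau ^+ i))).
  by rewrite unitmx_mul => /andP[].
have AE: map_mx iota A = W *m D *m invmx W by rewrite -AW mulmxK.
split.
  rewrite /field_trace -trace_map_mx -/A AE mxtrace_mulC mulKmx //.
  rewrite mxtrace_diag (big_nth 0) -dimn big_mkord.
  by apply: eq_bigr => k _; rewrite mxE.
exists (\det A); rewrite -det_map_mx AE !det_mulmx det_inv mulrAC divff.
  rewrite mul1r det_diag (big_nth 0) -dimn big_mkord.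
  by apply: eq_bigr => k _; rewrite mxE.
by rewrite -unitfE -unitmxE.
Qed.

End Trace.

(** [F] is K[X]/(P), the abstract form of K(z) that [deeply_ramified] asks for. *)
Lemma simple_extension_exists (K L : fieldType) (iota : {rmorphism K -> L})
    z P R : is_conjugates iota z P R ->
  exists (F : fieldExtType K) (j : {rmorphism F -> L}) (tau : F),
  [/\ forall a : K, j a%:A = iota a, j tau = z, \dim {:F} = size R &
      forall x : F, exists q, x = (map_poly (in_alg F) q).[tau]].
Proof.
move=> zPR; have Pz := conj_root zPR (conj_mem zPR).
have irrP := conj_irr zPR; have nz_P := irredp_neq0 irrP.
pose F := SubFieldExtType Pz irrP.
exists F, (@subfx_inj K L iota z P), (subfx_root iota z P); split.
- by move=> a; apply: subfx_inj_base.
- exact: subfx_inj_root.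
- by rewrite dimvf -[size R]/((size R).+1.-1) -(conj_size zPR).
by move=> x; have [q Eq] := subfxEroot Pz nz_P x; exists q.
Qed.

(** * Relative traces *)

Section ConjugateSums.

Variables (K L : fieldType) (iota : {rmorphism K -> L}).

Lemma map_comp_horner (p q : {poly K}) (r : L) :
  (map_poly iota (p \Po q)).[r] = (map_poly iota p).[(map_poly iota q).[r]].
Proof. by rewrite map_comp_poly horner_comp. Qed.

Section Given.

Variables (z : L) (P : {poly K}) (R : seq L).
Hypothesis zPR : is_conjugates iota z P R.

Lemma conj_sum_base (q : {poly K}) :
  exists a : K, iota a = \sum_(r <- R) (map_poly iota q).[r].
Proof.
have [F [j [tau [jE j_tau dimF genF]]]] := simple_extension_exists zPR.
by have [<- _] := trace_norm_conjugates zPR jE j_tau dimF genF q; eexists.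
Qed.

Lemma conj_prod_base (q : {poly K}) :
  exists a : K, iota a = \prod_(r <- R) (map_poly iota q).[r].
Proof.
have [F [j [tau [jE j_tau dimF genF]]]] := simple_extension_exists zPR.
by have [_] := trace_norm_conjugates zPR jE j_tau dimF genF q.
Qed.

(* The coefficients of the interpolation polynomial of c solve the linear     *)
(* system whose matrix is that of the trace form on 1, z, z^2, ...            *)
Lemma conj_interpolation (c : L -> L) :
  (forall q : {poly K}, exists a,
     iota a = \sum_(r <- R) c r * (map_poly iota q).[r]) ->
  exists g : {poly K}, forall r, r \in R -> (map_poly iota g).[r] = c r.
Proof.
move=> c_base; pose n := size R; pose rt (k : 'I_n) := R`_k.
pose V := Vandermonde n (\row_k rt k).
have Vu : V \in unitmx.
  rewrite unitmxE det_Vandermonde unitfE; apply/prodf_neq0 => i _.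
  apply/prodf_neq0 => k lt_ik; rewrite !mxE subr_eq0.
  by rewrite nth_uniq ?(conj_uniq zPR) // gtn_eqF.
have /choice[h hE] (m : nat) : exists a, iota a = \sum_(r <- R) r ^+ m.
  have [a Ea] := conj_sum_base 'X^m; exists a; rewrite Ea.
  by under eq_bigr do rewrite map_polyXn hornerXn.
have /choice[b bE] (m : nat) : exists a, iota a = \sum_(r <- R) c r * r ^+ m.
  have [a Ea] := c_base 'X^m; exists a; rewrite Ea.
  by under eq_bigr do rewrite map_polyXn hornerXn.
pose H := \matrix_(i < n, j < n) h (i + j)%N.
pose B := \col_(i < n) b i.
pose C := \col_(k < n) c (rt k).
(* As [H] is [V V^T], it is invertible over [K], and the solution [G] of [H G = B] satisfies
   [V^T G = C], that is, it interpolates [c]. *)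
have VVT : map_mx iota H = V *m V^T.
  apply/matrixP => i k; rewrite !mxE hE (big_nth 0) big_mkord.
  by apply: eq_bigr => l _; rewrite !mxE exprD.
have VC : map_mx iota B = V *m C.
  apply/matrixP => i k; rewrite !mxE bE (big_nth 0) big_mkord.
  by apply: eq_bigr => l _; rewrite !mxE mulrC.
have Hu : H \in unitmx.
  by rewrite -(map_unitmx iota) VVT unitmx_mul unitmx_tr Vu.
pose G := invmx H *m B.
have VG : V^T *m map_mx iota G = C.
  have: V *m (V^T *m map_mx iota G) = V *m C.
    by rewrite mulmxA -VVT -VC -map_mxM mulKVmx.
  by move/(congr1 (mulmx (invmx V))); rewrite !mulKmx.
exists (\sum_(i < n) G i 0 *: 'X^i) => r Rr.
have lt_r : (index r R < n)%N by rewrite index_mem.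
have ->: r = rt (Ordinal lt_r) by rewrite /rt /= nth_index.
have := congr1 (fun M : 'cV_n => M (Ordinal lt_r) 0) VG; rewrite !mxE => <-.
rewrite rmorph_sum /= horner_sum; apply: eq_bigr => i _.
by rewrite !mxE map_polyZ map_polyXn hornerZ hornerXn mulrC.
Qed.

End Given.

(** Here z = g(z'), so K(z) is contained in K(z'), and the conjugates of z' over K(z) are the roots
    in the fibre of g above z. The sum over that fibre is the relative trace of y(z'); [u]
    represents it as an element of K(z), and the second clause is transitivity of the trace, with
    factors from K(z) pulled out. The polynomial [u] comes from [conj_interpolation], since the sums
    to be tested are traces from K(z') to [K]. *)
Lemma conj_partial_sum z P R z' P' R' (g y : {poly K}) :
  is_conjugates iota z P R -> is_conjugates iota z' P' R' ->
  (map_poly iota g).[z'] = z ->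
  [/\ forall r, r \in R' -> (map_poly iota g).[r] \in R,
      forall w : {poly K},
        \sum_(r <- R') (map_poly iota y).[r] *
            (map_poly iota w).[(map_poly iota g).[r]] =
        \sum_(s <- R)
            (\sum_(r <- R' | (map_poly iota g).[r] == s) (map_poly iota y).[r]) *
            (map_poly iota w).[s]
    & exists u : {poly K}, forall s, s \in R ->
      (map_poly iota u).[s] =
        \sum_(r <- R' | (map_poly iota g).[r] == s) (map_poly iota y).[r]].
Proof.
move=> zPR z'PR' gz'.
have R'R r : r \in R' -> (map_poly iota g).[r] \in R.
  move=> R'r; rewrite -root_prod_XsubC -(conj_prod zPR).
  apply/rootP; rewrite -map_comp_horner.
  apply: (conj_horner0 z'PR' (conj_mem z'PR') R'r).
  by rewrite map_comp_horner gz'; apply/rootP/(conj_root zPR)/(conj_mem zPR).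
have sumE (w : {poly K}) :
    \sum_(r <- R') (map_poly iota y).[r] *
        (map_poly iota w).[(map_poly iota g).[r]] =
    \sum_(s <- R)
        (\sum_(r <- R' | (map_poly iota g).[r] == s) (map_poly iota y).[r]) *
        (map_poly iota w).[s].
  under [RHS]eq_bigr do rewrite mulr_suml big_mkcond.
  rewrite exchange_big /= big_seq [RHS]big_seq; apply: eq_bigr => r R'r.
  rewrite (bigD1_seq (map_poly iota g).[r]) ?R'R ?(conj_uniq zPR) //= eqxx.
  by rewrite big1_seq ?addr0 // => s /andP[/negPf]; rewrite eq_sym => ->.
split=> //; apply: conj_interpolation (zPR) _ _ => q.
have [a Ea] := conj_sum_base z'PR' (y * (q \Po g)).
exists a; rewrite Ea -sumE; apply: eq_bigr => r _.
by rewrite rmorphM hornerM map_comp_horner.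
Qed.

End ConjugateSums.

(** * Valuations of conjugates *)

Section ConjugateValuation.

Variables (K L : fieldType) (iota : {rmorphism K -> L}) (v : L -> \bar rat).
Hypothesis vP : is_valuation v.
Hypothesis K_complete : vcomplete v iota.
Variables (z : L) (P : {poly K}) (R : seq L).
Hypothesis zPR : is_conjugates iota z P R.

Lemma conj_coef_bounded r : r \in R ->
  exists C : rat, forall (h : {poly K}) c, (size h <= size R)%N ->
    vge v c (map_poly iota h).[r] -> forall i, vge v (c - C) (iota h`_i).
Proof.
move=> Rr; pose n := size R; pose e (i : 'I_n) := r ^+ i.
have hornE (h : {poly K}) : (size h <= n)%N ->
    (map_poly iota h).[r] = \sum_(i < n) iota h`_i * e i.
  move=> szh; rewrite (@horner_coef_wide _ n) ?size_map_poly //.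
  by apply: eq_bigr => i _; rewrite coef_map.
have free_e a : \sum_(i < n) iota (a i) * e i = 0 -> forall i, a i = 0.
  move=> a0 i; pose h := \sum_(i < n) a i *: 'X^i.
  have hi (l : 'I_n) : h`_l = a l.
    rewrite coef_sum (bigD1 l) //= coefZ coefXn eqxx mulr1 big1 ?addr0 // => k.
    by rewrite coefZ coefXn eq_sym -(inj_eq val_inj) => /negPf->; rewrite mulr0.
  have szh : (size h <= n)%N.
    apply/leq_sizeP => l le_nl; rewrite coef_sum big1 // => k _.
    by rewrite coefZ coefXn gtn_eqF ?mulr0 // (leq_trans _ le_nl).
  rewrite -hi; suff -> : h = 0 by rewrite coef0.
  apply/eqP; rewrite -size_poly_eq0 -leqn0 leqNgt; apply/negP => szh0.
  have: P %| h.
    apply: (irreducible_root_dvdp (conj_irr zPR) (conj_root zPR Rr)).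
    apply/rootP; rewrite hornE // -[RHS]a0; apply: eq_bigr => k _.
    by rewrite hi.
  move/dvdp_leq; rewrite -size_poly_gt0 => /(_ szh0).
  by rewrite (conj_size zPR) ltnNge szh.
have [C boundC] := coord_bounded vP K_complete free_e.
exists C => h c szh ch i; have [lt_in|le_ni] := ltnP i n; last first.
  by rewrite nth_default ?rmorph0 ?vge0 // (leq_trans szh).
by rewrite hornE // in ch; apply: (boundC (fun i => h`_i) c ch (Ordinal lt_in)).
Qed.

(** Bounded coordinates show that passing from r to s lowers a valuation by at most a constant
    independent of [h]. Applied to all powers of [h], this makes the loss zero. *)
Lemma conj_vge r s (h : {poly K}) c : r \in R -> s \in R ->
  vge v c (map_poly iota h).[r] -> vge v c (map_poly iota h).[s].
Proof.
move=> Rr Rs; have [C boundC] := conj_coef_bounded Rr.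
have [E sE] := vge_ex_fam vP (fun i : 'I_(size R) => s ^+ i).
have compare (g : {poly K}) d : vge v d (map_poly iota g).[r] ->
    vge v (d - C + E) (map_poly iota g).[s].
  have modE t : t \in R ->
      (map_poly iota g).[t] = (map_poly iota (g %% P)).[t].
    move=> Rt; rewrite {1}(divp_eq g P) rmorphD rmorphM hornerD hornerM.
    by rewrite (rootP (conj_root zPR Rt)) mulr0 add0r.
  have szm : (size (g %% P)%R <= size R)%N.
    by rewrite -ltnS -(conj_size zPR) ltn_modp (irredp_neq0 (conj_irr zPR)).
  rewrite !modE // => dr.
  rewrite (@horner_coef_wide _ (size R)) ?size_map_poly //.
  apply: (vge_sum vP) => i _; rewrite coef_map.
  by apply: (vgeM vP) => //; apply: boundC.
move=> ch; have [->|nz_hs] := eqVneq (map_poly iota h).[s] 0.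
  by rewrite vge0.
rewrite vgeE // leNgt; apply/negP => lt_sc.
set w := vval v _ in lt_sc.
have low n : n%:R * c - C + E <= n%:R * w.
  rewrite /w -vvalX // -vgeE ?expf_neq0 // -horner_exp -rmorphXn.
  by apply: compare; rewrite rmorphXn horner_exp vgeX.
(* For n > M the inequality [low n] fails. *)
pose M : rat := (C - E) / (c - w).
have h2 := archi_boundP (normr_ge0 M); have h1 := low (Num.bound `|M|).
have h3 := le_lt_trans (ler_norm M) h2.
rewrite ltr_pdivrMr ?subr_gt0 // in h3.
lra.
Qed.

Lemma conj_vval r s (h : {poly K}) : r \in R -> s \in R ->
  vval v (map_poly iota h).[r] = vval v (map_poly iota h).[s].
Proof.
move=> Rr Rs; have [h0|nz_hr] := eqVneq (map_poly iota h).[r] 0.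
  by rewrite h0 (conj_horner0 zPR Rr Rs h0).
have nz_hs : (map_poly iota h).[s] != 0.
  by apply: contra_neq nz_hr => /(conj_horner0 zPR Rs Rr).
apply/eqP; rewrite eq_le; apply/andP; split; rewrite -vgeE //.
  by apply: (conj_vge Rr Rs); rewrite vgeE.
by apply: (conj_vge Rs Rr); rewrite vgeE.
Qed.

(** The norm of h(z) lies in [K] and is a product of [size R] conjugates of equal valuation. *)
Lemma conj_vval_int (h : {poly K}) :
  (forall x : K, x != 0 -> vval v (iota x) \is a Num.int) ->
  (map_poly iota h).[z] != 0 ->
  (size R)%:R * vval v (map_poly iota h).[z] \is a Num.int.
Proof.
move=> valZ nz_hz; have [N EN] := conj_prod_base zPR h.
have nz_h r : r \in R -> (map_poly iota h).[r] != 0.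
  move=> Rr; apply: contra_neq nz_hz.
  exact: (conj_horner0 zPR Rr (conj_mem zPR)).
have [] : \prod_(r <- R) (map_poly iota h).[r] != 0 /\
   vval v (\prod_(r <- R) (map_poly iota h).[r]) =
     (size R)%:R * vval v (map_poly iota h).[z].
  have: {subset R <= R} by [].
  elim: {1 3 4 5}R => [|r R' IH] sR; first by rewrite !big_nil oner_neq0 vval1 ?mul0r.
  have Rr : r \in R by apply: sR; rewrite mem_head.
  have [|nz_pr vE] := IH; first by move=> s R's; apply: sR; rewrite in_cons R's orbT.
  rewrite !big_cons mulf_neq0 ?nz_h //; split=> //.
  rewrite vvalM ?nz_h // vE (conj_vval h Rr (conj_mem zPR)) /= -nat1r.
  by rewrite mulrDl mul1r.
rewrite -EN fmorph_eq0 => nz_N <-; exact: valZ.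
Qed.

End ConjugateValuation.

(** * Frobenius and p-adic residues *)

(** Since i C(p^a, i) = p^a C(p^a - 1, i - 1), a binomial coefficient prime to p would force p^a to
    divide i. *)
Lemma dvdn_bin_pfactor p a i : prime p -> (0 < i < p ^ a)%N -> (p %| 'C(p ^ a, i))%N.
Proof.
move=> p_pr /andP[i_gt0 lt_i]; apply: contraLR lt_i => ndvd.
have := mul_bin_diag (p ^ a) i.-1; rewrite prednK // => E.
have: (p ^ a %| i * 'C(p ^ a, i))%N by rewrite -E dvdn_mulr.
rewrite Gauss_dvdl; first by move/(dvdn_leq i_gt0); rewrite -leqNgt.
by apply: coprimeXl; rewrite prime_coprime.
Qed.

Section Frobenius.

Variables (F : fieldType) (v : F -> \bar rat).
Hypothesis vP : is_valuation v.
Variables (p : nat).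
Hypothesis p_pr : prime p.
Hypothesis vp1 : vge v 1 (p%:R : F).

(** Each mixed term of the binomial expansion has a coefficient divisible by p and at least one
    factor y. *)
Lemma vge_exprD a c x y : 0 <= c -> vge v 0 x -> vge v c y ->
  vge v (1 + c) ((x + y) ^+ (p ^ a) - x ^+ (p ^ a) - y ^+ (p ^ a)).
Proof.
move=> c_ge0 x0 yc; have q_gt0 : (0 < p ^ a)%N by rewrite expn_gt0 prime_gt0.
have y0 : vge v 0 y by apply: vge_trans yc.
rewrite exprDn -(prednK q_gt0) big_ord_recl big_ord_recr /=.
set S := \sum_(i < _) _.
rewrite bin0 expr0 mulr1 mulr1n subn0 {1 2 3}/bump !leq0n !add1n.
rewrite subnn expr0 mul1r binn mulr1n.
have ->: forall X Y : F, X + (S + Y) - X - Y = S by move=> X Y; ring.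
rewrite /S prednK //.
apply: vge_sum => // i _; rewrite /bump add1n.
have /dvdnP[k ->] : (p %| 'C(p ^ a, i.+1))%N.
  by apply: dvdn_bin_pfactor => //=; rewrite -ltn_predRL.
rewrite mulrnA -mulr_natl; apply: (vgeM vP) => //.
apply: vge_muln => //; apply: (vgeM0 vP); first exact: vgeX0.
by rewrite exprS -[c]addr0 vgeM // vgeX0.
Qed.

Lemma vge_frob_sub a x y : vge v 0 x -> vge v 0 y ->
  vge v 1 (x ^+ (p ^ a) - y ^+ (p ^ a) - (x - y) ^+ (p ^ a)).
Proof.
move=> x0 y0; have := @vge_exprD a 0 y (x - y) (lexx _) y0 (vgeB vP x0 y0).
by rewrite addr0 [y + _]addrC subrK.
Qed.

Lemma vge_sub_frob a x y : vge v 0 x -> vge v 0 y ->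
  vge v 1 (x ^+ (p ^ a) - y ^+ (p ^ a)) -> vge v 1 ((x - y) ^+ (p ^ a)).
Proof.
move=> x0 y0 h; rewrite -[_ ^+ _](subKr (x ^+ (p ^ a) - y ^+ (p ^ a))).
by rewrite vgeB // vge_frob_sub.
Qed.

Lemma vge_sub_exp n x y : vge v 0 x -> vge v 0 y ->
  vge v 1 (x - y) -> vge v 1 (x ^+ n - y ^+ n).
Proof.
move=> x0 y0 h; rewrite subrXX -[1]addr0 vgeM //.
by apply: vge_sum => // i _; rewrite -[0]addr0 vgeM // vgeX0.
Qed.

End Frobenius.

Section PadicField.

Variables (p : nat) (Qp : fieldType) (vp : Qp -> \bar rat).
Hypothesis p_pr : prime p.
Hypothesis Qp_padic : is_padic_field p vp.

Let vpP : is_valuation vp := padic_valuation Qp_padic.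

Lemma padic_nat n : (0 < n)%N -> vp n%:R = (logn p n)%:R%:E.
Proof.
move=> n_gt0; have := padic_ratr Qp_padic n%:R; rewrite ratr_nat => ->.
rewrite /rat_padic_val pnatr_eq0 gtn_eqF //.
by rewrite -[n%:R]/(n%:~R) numq_int denq_int /= logn1 subr0.
Qed.

Lemma padic_char0 n : n.+1%:R != 0 :> Qp.
Proof. by apply/eqP => /(valuation_eq0 vpP); rewrite padic_nat. Qed.

Lemma padic_int_ge0 (s : int) : vge vp 0 (s%:~R : Qp).
Proof.
by case: s => n; rewrite ?NegzE ?mulrNz ?vgeN // vge_nat.
Qed.

(** By density x may be replaced by a rational number; its valuation is nonnegative, so its
    denominator is prime to p and can be inverted modulo p. *)
Lemma padic_residue (x : Qp) : vge vp 0 x ->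
  exists a : 'I_p, (0 < vp (x - (a : nat)%:R))%E.
Proof.
move=> x0; have [q ltq] := padic_dense Qp_padic x 0.
have q0 : vge vp 0 (ratr q : Qp).
  by rewrite -[ratr q](subKr x) vgeB // /vge ltW.
pose m := `|denq q|%N.
have m_gt0 : (0 < m)%N by rewrite absz_gt0 denq_neq0.
have mE : denq q = m by rewrite /m absz_denq.
have pm : coprime m p.
  rewrite coprime_sym prime_coprime //; apply/negP => p_m.
  have nz_q : q != 0.
    apply: contraTneq p_m => q00.
    by rewrite /m q00 -[0]/(0%:~R) denq_int dvdn1 gtn_eqF ?prime_gt1.
  move: q0; rewrite /vge (padic_ratr Qp_padic) /rat_padic_val (negPf nz_q) lee_fin.
  have : logn p `|numq q| = 0%N.
    apply/eqP; rewrite -leqn0 leqNgt logn_gt0 mem_primes p_pr /=.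
    apply/negP => /andP[_ p_num].
    have := coprime_num_den q; rewrite /coprime => /eqP g1.
    have : (p %| gcdn `|numq q| `|denq q|)%N by rewrite dvdn_gcd p_num.
    by rewrite g1 dvdn1 gtn_eqF ?prime_gt1.
  move=> ->; rewrite -/m sub0r oppr_ge0 lern0 -leqn0 leqNgt logn_gt0 mem_primes.
  by rewrite p_pr m_gt0 p_m.
case: (egcdnP p m_gt0) => u w; rewrite (eqP pm) => uw _.
(* By the Bezout relation [uw], [u] is an inverse of the denominator [m] modulo p. *)
pose a := (numq q * u%:Z %% p)%Z; have p_gt0 := prime_gt0 p_pr.
have nz_p : (p : int) != 0 by rewrite eqz_nat -lt0n.
have a_ge0 : 0 <= a by rewrite modz_ge0.
have lt_a : (`|a| < p)%N.
  by rewrite -ltz_nat gez0_abs // ltz_pmod // ltz_nat.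
exists (Ordinal lt_a).
have aE : (`|a|%N : int) = a by rewrite gez0_abs.
pose s : int := (numq q * u%:Z %/ p)%Z * m%:Z - numq q * w%:Z.
have sE : numq q - a * m%:Z = p%:Z * s.
  have := divz_eq (numq q * u%:Z) p; rewrite -/a /s => dE.
  have uwz : u%:Z * m%:Z = w%:Z * p%:Z + 1 by rewrite -!PoszM uw PoszD.
  have -> : a = numq q * u%:Z - (numq q * u%:Z %/ p)%Z * p%:Z.
    by rewrite {1}dE addrC addKr.
  rewrite mulrBl -[numq q * u%:Z * m%:Z]mulrA uwz; ring.
have nz_m : (m%:R : Qp) != 0 by rewrite -(prednK m_gt0) padic_char0.
have aqE : ratr q - (Ordinal lt_a : nat)%:R = p%:R * s%:~R / m%:R :> Qp.
  rewrite /ratr mE -[p%:R]/((p : int)%:~R) -intrM -sE rmorphB rmorphM /=.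
  rewrite mulrBl -[(Posz m)%:~R]/(m%:R) mulfK //; congr (_ - _).
  by rewrite -aE.
have qa : vge vp 1 (ratr q - (Ordinal lt_a : nat)%:R : Qp).
  rewrite aqE -[1]addr0 vgeM //; last first.
    rewrite vgeE ?invr_eq0 // vvalV // /vval padic_nat //=.
    rewrite lognE (_ : (p %| m)%N = false) ?andbF ?oppr0 //.
    by apply/negbTE; rewrite -prime_coprime // coprime_sym.
  rewrite -[1]addr0 vgeM ?padic_int_ge0 // /vge padic_nat //.
  by rewrite (pfactorK 1 p_pr : logn p p = 1%N).
rewrite -(subrK (ratr q) x) -addrA.
by apply: lt_le_trans (valuationD vpP _ _); rewrite lt_min ltq (lt_le_trans _ qa).
Qed.

End PadicField.

(** * Finite extensions of a p-adic field *)

Section PadicExtension.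

Variables (p : nat) (Qp : fieldType) (vp : Qp -> \bar rat).
Hypotheses (p_pr : prime p) (Qp_padic : is_padic_field p vp).
Variables (K : fieldExtType Qp) (Kbar : closedFieldType).
Variables (iota : {rmorphism K -> Kbar}) (v : Kbar -> \bar rat).
Hypothesis v_norm : is_normalized_valuation vp iota v.

Let vP : is_valuation v := normalized_valuation v_norm.
Let vpP : is_valuation vp := padic_valuation Qp_padic.

Lemma ext_char0 n : n.+1%:R != 0 :> K.
Proof.
by rewrite -(rmorph_nat (in_alg K)) fmorph_eq0 (padic_char0 Qp_padic).
Qed.

Lemma ext_vge_scale : exists2 e : rat, 0 < e &
  forall (x : Qp) c, vge v (e * c) (iota x%:A) = vge vp c x.
Proof.
have [e e_gt0 eE] := normalized_extends v_norm; exists e => // x c.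
have [->|nz_x] := eqVneq x 0; first by rewrite scale0r rmorph0 !vge0.
by rewrite /vge eE (valE vpP nz_x) !lee_fin ler_pM2l.
Qed.

Lemma ext_val_gt0 (x : Qp) : (0 < vp x)%E -> (0 < v (iota x%:A))%E.
Proof.
have [e e_gt0 eE] := normalized_extends v_norm; rewrite eE.
have [->|nz_x] := eqVneq x 0; first by rewrite (val0 vpP) mulry gtr0_sg // mul1e.
by rewrite (valE vpP nz_x) !lte_fin => x_gt0; rewrite mulr_gt0.
Qed.

Lemma base_complete : vcomplete v (iota \o in_alg K).
Proof.
have [e e_gt0 eE] := ext_vge_scale => u u_cauchy.
have [|l lP] := padic_complete Qp_padic (u := u).
  (* The extra 1 turns the weak inequality of [vge] into the strict one of [padic_complete]. *)
  move=> B; have [N NP] := u_cauchy (e * (B + 1)).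
  exists N => m n Nm Nn; have := NP m n Nm Nn; rewrite /= eE.
  by apply: lt_le_trans; rewrite lte_fin ltrDl.
exists l => c; have [N NP] := lP (e^-1 * c); exists N => n Nn /=.
have := NP n Nn => /ltW; rewrite -/(vge vp _ _) -eE mulrA divff ?mul1r //.
by rewrite gt_eqF.
Qed.

Lemma ext_complete : vcomplete v iota.
Proof. by apply: (vcomplete_ext vP); exact: base_complete. Qed.

Lemma uniformizer_valX (pi : K) (m : int) : vval v (iota pi) = 1 -> pi != 0 ->
  vval v (iota (pi ^ m)) = m%:~R.
Proof.
move=> vpi1 nz_pi; have nz_ipi : iota pi != 0 by rewrite fmorph_eq0.
case: m => m; first by rewrite -exprnP rmorphXn vvalX // vpi1 mulr1.
by rewrite NegzE -exprnN fmorphV rmorphXn vvalV ?expf_neq0 // vvalX // vpi1 mulr1 mulrNz.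
Qed.

Lemma ext_val_surj (m : int) : exists2 c : K, c != 0 & vval v (iota c) = m%:~R.
Proof.
have [pi _ vpi] := normalized_uniformizer v_norm.
have nz_pi : pi != 0.
  by apply/eqP => pi0; move: vpi; rewrite pi0 rmorph0 (val0 vP).
exists (pi ^ m); first by rewrite expfz_neq0.
by apply: uniformizer_valX; rewrite // /vval vpi.
Qed.

(** Dividing x by a power of the uniformizer brings its valuation into [0, 1). If it were positive
    there, the quotient would be divisible by the uniformizer and have valuation at least 1. *)
Lemma ext_val_int (x : K) : x != 0 -> vval v (iota x) \is a Num.int.
Proof.
move=> nz_x; have [pi [_ piM] vpi] := normalized_uniformizer v_norm.
have nz_pi : pi != 0.
  by apply/eqP => pi0; move: vpi; rewrite pi0 rmorph0 (val0 vP).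
have vpi1 : vval v (iota pi) = 1 by rewrite /vval vpi.
pose k := Num.floor (vval v (iota x)).
pose y := x * pi ^ (- k).
have nz_y : y != 0 by rewrite mulf_neq0 // expfz_neq0.
have vy : vval v (iota y) = vval v (iota x) - k%:~R.
  by rewrite rmorphM vvalM ?fmorph_eq0 ?expfz_neq0 // uniformizer_valX // mulrNz.
have /andP[y_ge0 y_lt1] : 0 <= vval v (iota y) < 1.
  have /andP[] := floor_itv (vval v (iota x)); rewrite -/k vy rmorphD /= => k1 k2.
  by apply/andP; split; lra.
have [y0|y_gt0] := eqVneq (vval v (iota y)) 0.
  by move: vy; rewrite y0 => /esym/eqP; rewrite subr_eq0 => /eqP->; rewrite intr_int.
have y_pos : 0 < vval v (iota y) by rewrite lt_neqAle eq_sym y_gt0.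
have [|z] := piM y.
  by rewrite inE /= (valE vP) ?fmorph_eq0 // lte_fin.
rewrite inE /= => z_ge0 Ey; have nz_z : z != 0.
  by apply: contraNneq nz_y => z0; rewrite Ey z0 mulr0.
move: y_lt1; rewrite Ey rmorphM vvalM ?fmorph_eq0 // vpi1.
move: z_ge0; rewrite (valE vP) ?fmorph_eq0 // lee_fin; lra.
Qed.

(** Discreteness turns congruences modulo the maximal ideal of [K] into [vge v 1], a form that also
    makes sense in [Kbar]. *)
Lemma ext_pos_ge1 (x : K) : (0 < v (iota x))%E -> vge v 1 (iota x).
Proof.
have [->|nz_x] := eqVneq x 0; first by rewrite rmorph0 vge0.
have nz_ix : iota x != 0 by rewrite fmorph_eq0.
rewrite (valE vP) // lte_fin vgeE //.
by have /intrP[m ->] := ext_val_int nz_x; rewrite ltr0z ler1z gtz0_ge1.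
Qed.

Lemma ext_vge_p : vge v 1 (p%:R : Kbar).
Proof.
rewrite -(rmorph_nat iota); apply: ext_pos_ge1.
rewrite -(rmorph_nat (in_alg K)); apply: ext_val_gt0.
rewrite (padic_nat Qp_padic) ?prime_gt0 // lte_fin ltr0n.
by rewrite (pfactorK 1 p_pr : logn p p = 1%N).
Qed.

(* The residue field is finite: modulo the maximal ideal all powers of x are  *)
(* combinations of 1, ..., x^(d-1) with coefficients in {0, ..., p-1}, where  *)
(* d is the degree of x over Qp.                                              *)
Lemma ext_residue_powers (x : K) : vge v 0 (iota x) ->
  exists d, forall n, exists a : {ffun 'I_d -> 'I_p},
    vge v 1 (iota (x ^+ n - \sum_i (a i : nat)%:R * x ^+ i)).
Proof.
move=> x0; pose i0 : {rmorphism Qp -> Kbar} := iota \o in_alg K.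
have [e e_gt0 eE] := ext_vge_scale.
have x_alg : algebraicOver i0 (iota x).
  have /polyOver1P[q Eq] := minPolyOver 1%AS x.
  exists q; first by rewrite -(map_poly_eq0 (in_alg K)) -Eq monic_neq0 ?monic_minPoly.
  by rewrite map_poly_comp fmorph_root -Eq root_minPoly.
have [P [R xPR]] := conjugates_exist (padic_char0 Qp_padic) x_alg.
have R0 r : r \in R -> vge v 0 r.
  move=> Rr; have := conj_vge vP base_complete xPR (conj_mem xPR) Rr (h := 'X) (c := 0).
  by rewrite map_polyX !hornerX; apply.
(* Up to sign, the coefficients of [P] are sums of products of its integral roots. *)
have P0 i : vge v 0 (i0 P`_i).
  rewrite -coef_map (conj_prod xPR); have : {in R, forall r, vge v 0 r} by [].
  elim: {1 2}R i => [|r R' IH] i R'0.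
    by rewrite big_nil coef1; case: eqP => _; rewrite ?vge1 ?vge0.
  rewrite big_cons mulrBl mul_polyC coefB coefXM coefZ.
  have R'0' : {in R', forall r, vge v 0 r}.
    by move=> s R's; apply: R'0; rewrite in_cons R's orbT.
  apply: (vgeB vP); first by case: eqP => _; [exact: vge0 | apply: IH].
  by apply: (vgeM0 vP); [apply: R'0; rewrite mem_head | apply: IH].
pose d := size R; exists d => n.
have [b [szb b0 bE]] : exists b : {poly Qp}, [/\ (size b <= d)%N,
    forall i, vge v 0 (i0 b`_i) & x ^+ n = (map_poly (in_alg K) b).[x]].
  elim: n => [|n [b [szb b0 bE]]].
    exists 1; split; last by rewrite rmorph1 hornerC.
      by rewrite size_poly1 /d; case: (R) (conj_mem xPR).
    by move=> i; rewrite coef1; case: eqP => _; rewrite ?rmorph1 ?rmorph0 ?vge1 ?vge0.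
  have Pd : P`_d = 1.
    by have := monicP (conj_monic xPR); rewrite lead_coefE (conj_size xPR).
  (* The term of degree d of [b * 'X] is cancelled against the monic [P], which vanishes at x. *)
  exists (b * 'X - b`_d.-1 *: P); split.
  - have d_gt0 : (0 < d)%N by rewrite /d; case: (R) (conj_mem xPR).
    apply/leq_sizeP => i; rewrite coefB coefMX coefZ leq_eqVlt.
    case/predU1P=> [<-|lt_di]; first by rewrite gtn_eqF // Pd mulr1 subrr.
    have i_gt0 := leq_ltn_trans (leq0n d) lt_di.
    rewrite gtn_eqF // [b`_i.-1]nth_default; last first.
      by rewrite (leq_trans szb) // -ltnS prednK.
    by rewrite [P`_i]nth_default ?mulr0 ?subrr // (conj_size xPR).
  - move=> i; rewrite coefB coefMX coefZ rmorphB rmorphM.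
    apply: (vgeB vP); last exact: (vgeM0 vP).
    by case: eqP => _; rewrite ?rmorph0 ?vge0.
  rewrite exprSr bE rmorphB rmorphM /= map_polyX map_polyZ hornerD hornerN.
  rewrite hornerMX hornerZ.
  have -> : (map_poly (in_alg K) P).[x] = 0.
    apply/rootP; rewrite -(fmorph_root iota) -map_poly_comp.
    exact: (conj_root xPR (conj_mem xPR)).
  by rewrite mulr0 subr0.
have /choice[a aP] (i : 'I_d) : exists a : 'I_p, (0 < vp (b`_i - (a : nat)%:R))%E.
  apply: (padic_residue p_pr Qp_padic); rewrite -eE mulr0; exact: b0.
exists [ffun i => a i].
rewrite bE (@horner_coef_wide _ d) ?size_map_poly // -sumrB rmorph_sum.
apply: (vge_sum vP) => i _; rewrite ffunE coef_map -mulrBl rmorphM /=.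
rewrite -[1]addr0; apply: (vgeM vP); last by rewrite rmorphXn; apply: vgeX0.
apply: ext_pos_ge1.
rewrite (_ : _ - _ = (b`_i - (a i : nat)%:R)%:A); first exact: ext_val_gt0.
by rewrite scalerBl scaler_nat.
Qed.

(** By the pigeonhole principle x^(p^i) and x^(p^l) are congruent for some i < l. Their difference
    is congruent to the p^i-th power of x^(p^(l-i)) - x, which thus has positive valuation, hence
    valuation at least 1. *)
Lemma ext_frobenius_periodic (x : K) : vge v 0 (iota x) ->
  exists2 k, (0 < k)%N & vge v 1 (iota (x ^+ (p ^ k) - x)).
Proof.
move=> x0; have [d /choice[a aP]] := ext_residue_powers x0.
pose T := {ffun 'I_d -> 'I_p}.
pose g (i : 'I_#|T|.+1) := a (p ^ i)%N.
have [i [l [lt_il Eg]]] : exists i l : 'I_#|T|.+1, (i < l)%N /\ g i = g l.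
  apply: contrapT => /forallNP no_i.
  suff /leq_card : injective g by rewrite card_ord ltnn.
  move=> i l Eg; apply: contrapT => /eqP; rewrite neq_ltn => /orP[] lt.
    by case: (no_i i); exists l.
  by case: (no_i l); exists i.
exists (l - i)%N; first by rewrite subn_gt0.
apply: ext_pos_ge1.
have p_gt0 := prime_gt0 p_pr.
have : vge v 1 (iota (x ^+ (p ^ (l - i)) - x) ^+ (p ^ i)).
  rewrite rmorphB; apply: (vge_sub_frob vP p_pr ext_vge_p) => //.
    by rewrite rmorphXn vgeX0.
  rewrite -!rmorphXn -exprM -expnD subnK 1?ltnW // -rmorphB.
  have -> : x ^+ (p ^ l) - x ^+ (p ^ i) =
    (x ^+ (p ^ l) - \sum_s (g l s : nat)%:R * x ^+ s) -
    (x ^+ (p ^ i) - \sum_s (g i s : nat)%:R * x ^+ s) by rewrite Eg; ring.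
  by rewrite rmorphB; apply: (vgeB vP); apply: aP.
set y := iota _; have [->|nz_y] := eqVneq y 0; first by rewrite (val0 vP) lt0y.
rewrite vgeE ?expf_neq0 // vvalX // (valE vP) // lte_fin => h.
rewrite -(@pmulr_rgt0 _ (p ^ i)%:R) ?ltr0n ?expn_gt0 ?p_gt0 //.
exact: lt_le_trans ltr01 h.
Qed.

End PadicExtension.

(** * The different *)

Section Different.

Variables (K L : fieldType) (iota : {rmorphism K -> L}) (v : L -> \bar rat).
Hypothesis vP : is_valuation v.
Hypothesis K_complete : vcomplete v iota.
Hypothesis K_char0 : forall n, n.+1%:R != 0 :> K.
Hypothesis val_int : forall x : K, x != 0 -> vval v (iota x) \is a Num.int.
Hypothesis val_surj : forall m : int,
  exists2 c : K, c != 0 & vval v (iota c) = m%:~R.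
Variables (z : L) (P : {poly K}) (R : seq L).
Hypothesis zPR : is_conjugates iota z P R.
Variables (F : fieldExtType K) (j : {rmorphism F -> L}) (tau : F).
Hypothesis jE : forall a : K, j a%:A = iota a.
Hypothesis j_tau : j tau = z.
Hypothesis dimF : \dim {:F} = size R.
Hypothesis genF : forall x : F, exists q, x = (map_poly (in_alg F) q).[tau].

Lemma conj_size_gt0 : (0 < size R)%N.
Proof. by case: (R) (conj_mem zPR). Qed.

Lemma val_ringE x : (x \in val_ring (v \o j)) = vge v 0 (j x).
Proof. by []. Qed.

Lemma codifferentP x : codifferent (v \o j) x <->
  forall y, vge v 0 (j y) -> vge v 0 (iota (field_trace (x * y))).
Proof. by split=> h y /h; rewrite inE /= jE. Qed.

Lemma field_trace_scalar (c : K) : field_trace (c%:A : F) = c * (size R)%:R.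
Proof.
apply: (fmorph_inj iota).
have [tE _] := trace_norm_conjugates zPR jE j_tau dimF genF c%:P.
rewrite map_polyC hornerC in tE; rewrite tE map_polyC.
under eq_bigr do rewrite hornerC.
by rewrite big_const_seq count_predT iter_addr addr0 rmorphM rmorph_nat mulr_natr.
Qed.

Lemma ext_vval_int (x : F) : x != 0 -> (size R)%:R * vval v (j x) \is a Num.int.
Proof.
move=> nz_x; have [q Eq] := genF x.
have jx : j x = (map_poly iota q).[z] by rewrite Eq (j_horner jE j_tau).
rewrite jx; apply: (conj_vval_int vP K_complete zPR val_int).
by rewrite -jx fmorph_eq0.
Qed.

(** An element x is tested against c / x, where c in [K] has the least integer valuation above that
    of x: the trace of c is c times the degree, so v(c) is bounded below. *)
Lemma codifferent_bounded : exists M : nat, forall x, codifferent (v \o j) x ->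
  x != 0 -> - M%:R <= vval v (j x).
Proof.
have nz_d : (size R)%:R != 0 :> K by rewrite -(prednK conj_size_gt0) K_char0.
exists (Num.bound `|vval v (iota (size R)%:R) + 1|) => x /codifferentP xC nz_x.
set d := vval v (iota _); pose m : int := Num.floor (vval v (j x)) + 1.
have /andP[m1 m2] := floor_itv (vval v (j x)); rewrite -/m in m2.
have mE : m%:~R = (Num.floor (vval v (j x)))%:~R + 1 :> rat by rewrite rmorphD.
have [c nz_c vc] := val_surj m.
have nz_jx : j x != 0 by rewrite fmorph_eq0.
have := xC (x^-1 * c%:A); rewrite rmorphM jE fmorphV.
have nz_ic : iota c != 0 by rewrite fmorph_eq0.
rewrite vgeE ?mulf_neq0 ?invr_eq0 // vvalM ?invr_eq0 // vvalV // vc.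
rewrite addrC subr_ge0 => /(_ (ltW m2)); rewrite mulVKf // field_trace_scalar.
rewrite rmorphM vgeE ?mulf_neq0 ?fmorph_eq0 // vvalM ?fmorph_eq0 // vc -/d => h.
have := le_lt_trans (ler_norm (d + 1)) (archi_boundP (normr_ge0 (d + 1))).
lra.
Qed.

(** Valuations on [F] have bounded denominators, so the codifferent contains an element [x0] of
    least valuation, and the inverse of [x0] generates the different. *)
Lemma different_valuation_exists z0 : z0 != 0 -> codifferent (v \o j) z0 ->
  exists2 d, different_valuation (v \o j) d & - vval v (j z0) <= d.
Proof.
move=> nz_z0 z0C; have [M bound_M] := codifferent_bounded.
have d_gt0 : 0 < (size R)%:R :> rat by rewrite ltr0n conj_size_gt0.
pose Q n := `[< exists x, [/\ codifferent (v \o j) x, x != 0 &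
  (size R)%:R * (vval v (j x) + M%:R) = n%:R] >].
have Qex x : codifferent (v \o j) x -> x != 0 ->
    exists2 n, (size R)%:R * (vval v (j x) + M%:R) = n%:R & Q n.
  move=> xC nz_x; have /intrP[m Em] := ext_vval_int nz_x.
  have : (size R)%:R * (vval v (j x) + M%:R) = (m + (size R * M)%N%:Z)%:~R.
    by rewrite mulrDr Em rmorphD /= -pmulrn natrM.
  have : 0 <= (size R)%:R * (vval v (j x) + M%:R).
    by have := bound_M _ xC nz_x; rewrite pmulr_rge0 //; lra.
  move=> ge0 E; rewrite E ler0z in ge0; case: (m + _) ge0 E => // n _ E.
  by exists n => //; apply/asboolP; exists x.
have [n0 _ Qn0] := Qex _ z0C nz_z0.
have exQ : exists n, Q n by exists n0.
case: (ex_minnP exQ) => n /asboolP[x0 [x0C nz_x0 En]] minQ.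
have x0_min x : codifferent (v \o j) x -> x != 0 -> vval v (j x0) <= vval v (j x).
  move=> xC nz_x; have [n' En' /minQ le_n] := Qex x xC nz_x.
  rewrite -(lerD2r M%:R) -(ler_pM2l d_gt0) En En' ler_nat //.
exists (- vval v (j x0)); last by rewrite lerN2 x0_min.
have nz_jx0 : j x0 != 0 by rewrite fmorph_eq0.
exists x0^-1; last by rewrite /= fmorphV (valE vP) ?invr_eq0 // vvalV.
apply/seteqP; split=> [w wD | _ [y /= y0 <-] x xC].
  by exists (w * x0); [apply: wD | rewrite mulrC mulfK].
have [->|nz_x] := eqVneq x 0; first by rewrite mulr0 val_ringE rmorph0 vge0.
rewrite val_ringE -mulrA mulrCA rmorphM; apply: (vgeM0 vP) => //.
rewrite rmorphM fmorphV vgeE ?mulf_neq0 ?invr_eq0 ?fmorph_eq0 //.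
rewrite vvalM ?invr_eq0 ?fmorph_eq0 // vvalV // addrC subr_ge0.
exact: x0_min.
Qed.

End Different.

(** * Iterated preimages of t0 *)

Section Iteration.

Variables (K : fieldType) (L : closedFieldType) (iota : {rmorphism K -> L}).
Variable (v : L -> \bar rat).
Hypothesis vP : is_valuation v.
Hypothesis K_complete : vcomplete v iota.
Hypothesis K_char0 : forall n, n.+1%:R != 0 :> K.
Hypothesis val_int : forall x : K, x != 0 -> vval v (iota x) \is a Num.int.
Hypothesis val_surj : forall m : int,
  exists2 c : K, c != 0 & vval v (iota c) = m%:~R.
Variables (p a : nat).
Hypothesis p_pr : prime p.
Hypothesis vp1 : vge v 1 (p%:R : L).
Variable (f : {poly K}).
Hypothesis f_monic : f \is monic.
Hypothesis f_deg : (2 <= (size f).-1 <= p ^ a)%N.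
Hypothesis f_cong : forall i, vge v 1 (iota (f - 'X^(p ^ a))`_i).

Let q := (p ^ a)%N.
Let phi (y : L) := (map_poly iota f).[y].

Let q_gt1 : (1 < q)%N.
Proof. by case/andP: f_deg => h1 h2; apply: leq_trans h2. Qed.

Let q_gt0 : (0 < q)%N.
Proof. exact: ltnW. Qed.

Let qX s : (q ^ s = p ^ (a * s))%N.
Proof. by rewrite expnM. Qed.

Lemma f_coef_ge0 i : vge v 0 (iota f`_i).
Proof.
have := f_cong i; rewrite coefB coefXn rmorphB => h.
rewrite -[iota f`_i](subrK (iota (i == p ^ a)%N%:R)) vgeD //.
  by apply: vge_trans h; rewrite ler01.
by case: eqP => _; rewrite ?rmorph1 ?rmorph0 ?vge1 ?vge0.
Qed.

Lemma vge_horner (h : {poly K}) c y : (forall i, vge v c (iota h`_i)) ->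
  vge v 0 y -> vge v c (map_poly iota h).[y].
Proof.
move=> hc y0; rewrite horner_coef; apply: vge_sum => // i _.
by rewrite coef_map -[c]addr0; apply: (vgeM vP) (hc i) _; apply: vgeX0.
Qed.

Lemma phi_cong y : vge v 0 y -> vge v 1 (phi y - y ^+ q).
Proof.
move=> y0; rewrite /phi -(hornerXn y q) -(map_polyXn iota) -hornerN -hornerD -rmorphB.
exact: vge_horner.
Qed.

Lemma phi_ge0 y : vge v 0 y -> vge v 0 (phi y).
Proof. by move=> y0; apply: vge_horner => // i; apply: f_coef_ge0. Qed.

(** If v(y) < 0, the leading term of the monic f dominates and f(y) has negative valuation. *)
Lemma phi_ge0_inv y : vge v 0 (phi y) -> vge v 0 y.
Proof.
move=> fy0; have [->|nz_y] := eqVneq y 0; first by rewrite vge0.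
rewrite vgeE // leNgt; apply/negP => lt_y.
set d := (size f).-1; have d_gt0 : (0 < d)%N by case/andP: f_deg => /ltnW.
have szf : size f = d.+1 by rewrite prednK // size_poly_gt0 monic_neq0.
have vyd : vval v (y ^+ d) = d%:R * vval v y by rewrite vvalX.
have [] := @vval_close _ _ vP (d.-1%:R * vval v y) (y ^+ d) (phi y).
- by rewrite expf_neq0.
- rewrite /phi horner_coef size_map_poly szf big_ord_recr /= !coef_map /=.
  have -> : iota f`_d = 1 by rewrite -lead_coefE (monicP f_monic) rmorph1.
  rewrite mul1r addrK; apply: vge_sum => // i _.
  rewrite coef_map; apply: (vgeM0 vP); first exact: f_coef_ge0.
  rewrite vgeE ?expf_neq0 // vvalX // ler_nM2r // ler_nat.
  by rewrite -ltnS prednK.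
- by rewrite vyd ltr_nM2r // ltr_nat prednK.
move=> nz_fy vfy; move: fy0; rewrite vgeE // vfy vyd.
by rewrite nmulr_lge0 // lern0 -leqn0 leqNgt d_gt0.
Qed.

(** In f = g + X^q the coefficients of g contribute 1. In x^q - y^q the mixed terms gain 1, and (x -
    y)^q has valuation at least q c >= 1 + c because c >= 1 and q >= 2. *)
Lemma phi_contract c x y : 1 <= c -> vge v 0 x -> vge v 0 y ->
  vge v c (x - y) -> vge v (1 + c) (phi x - phi y).
Proof.
move=> c_ge1 x0 y0 cxy; pose g := f - 'X^q.
have phiE t : phi t = (map_poly iota g).[t] + t ^+ q.
  by rewrite /phi /g rmorphB /= hornerD hornerN map_polyXn hornerXn subrK.
have -> : phi x - phi y = ((map_poly iota g).[x] - (map_poly iota g).[y])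
    + (x ^+ q - y ^+ q) by rewrite !phiE; ring.
apply: (vgeD vP).
  rewrite !horner_coef -sumrB; apply: vge_sum => // i _.
  rewrite -mulrBr coef_map subrXX; apply: (vgeM vP); first exact: f_cong.
  rewrite -[c]addr0; apply: (vgeM vP) => //; apply: vge_sum => // l _.
  by rewrite -[0]addr0 vgeM // vgeX0.
have -> : x ^+ q - y ^+ q =
    ((y + (x - y)) ^+ q - y ^+ q - (x - y) ^+ q) + (x - y) ^+ q.
  by rewrite [y + _]addrC subrK subrK.
apply: (vgeD vP); first by apply: (vge_exprD vP p_pr vp1) => //; lra.
apply: vge_trans (vgeX vP q cxy).
have : 2 <= q%:R :> rat by rewrite ler_nat.
nra.
Qed.

(** The iterate is needed as a polynomial: it expresses [t n] in terms of [t (n + s)] and can be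
    evaluated at conjugates. *)
Definition fiter s : {poly K} := iter s (fun h => f \Po h) 'X.

Lemma fiterE s y : (map_poly iota (fiter s)).[y] = iter s phi y.
Proof.
elim: s => [|s IH]; first by rewrite /= map_polyX hornerX.
by rewrite /= map_comp_horner IH.
Qed.

Lemma fiter_size s : (1 < size (fiter s) <= (q ^ s).+1)%N.
Proof.
have -> : size (fiter s) = ((size f).-1 ^ s).+1.
  elim: s => [|s IH]; first by rewrite /= size_polyX.
  have: (size (f \Po fiter s)).-1 = ((size f).-1 ^ s.+1)%N.
    by rewrite size_comp_poly IH /= expnS.
  rewrite /= => <-; rewrite prednK // size_poly_gt0 comp_poly_eq0 ?monic_neq0 //.
  rewrite IH ltnS expn_gt0; case/andP: f_deg => h _.
  by rewrite (leq_trans _ h).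
case/andP: f_deg => h1 h2; rewrite !ltnS expn_gt0 (leq_trans _ h1) //=.
by case: s => // s; rewrite leq_exp2r.
Qed.

Lemma iter_ge0 s y : vge v 0 y -> vge v 0 (iter s phi y).
Proof. by move=> y0; elim: s => //= s; apply: phi_ge0. Qed.

Lemma iter_cong s y : vge v 0 y -> vge v 1 (iter s phi y - y ^+ (q ^ s)).
Proof.
move=> y0; elim: s => [|s IH]; first by rewrite expn0 expr1 subrr vge0.
rewrite iterS; apply: (vge_subtrans vP) (phi_cong (iter_ge0 s y0)) _.
by rewrite expnSr exprM; apply: (vge_sub_exp vP) => //; rewrite ?iter_ge0 ?vgeX0.
Qed.

Lemma iter_contract s x y : vge v 0 x -> vge v 0 y -> vge v 1 (x - y) ->
  vge v (1 + s%:R) (iter s phi x - iter s phi y).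
Proof.
move=> x0 y0 xy; elim: s => [|s IH]; first by rewrite addr0.
have -> : 1 + s.+1%:R = 1 + (1 + s%:R) :> rat by rewrite -nat1r.
apply: phi_contract => //; try exact: iter_ge0.
by rewrite lerDl ler0n.
Qed.

(** The powers x^(q^s) and y^(q^s) are both congruent to the common image, so (x - y)^(q^s) has
    valuation at least 1. *)
Lemma iter_fibre_close s x y : vge v 0 x -> vge v 0 y ->
  iter s phi x = iter s phi y -> vge v ((q ^ s)%:R^-1) (x - y).
Proof.
move=> x0 y0 E; have qs_gt0 : (0 < q ^ s)%N by rewrite expn_gt0 q_gt0.
apply: (vge_root vP qs_gt0); rewrite divff ?pnatr_eq0 -?lt0n //.
rewrite qX; apply: (vge_sub_frob vP p_pr vp1) => //; rewrite -qX.
apply: (vge_subtrans vP) (_ : vge v 1 (iter s phi x - y ^+ _)).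
  by rewrite vge_subC // iter_cong.
by rewrite E iter_cong.
Qed.

(** * The backward orbit of t0 and its gaps *)

Variables (t0 : K) (t : nat -> L) (k : nat).
Hypothesis t0_int : vge v 0 (iota t0).
Hypothesis t0_periodic : vge v 1 (iota (t0 ^+ (p ^ k.+1) - t0)).
Hypothesis t_0 : t 0%N = iota t0.
Hypothesis t_step : forall n, phi (t n.+1) = t n.
Hypothesis t_alg : forall n, algebraicOver iota (t n).

Lemma t_iter s n : iter s phi (t (n + s)) = t n.
Proof.
elim: s n => [|s IH] n; first by rewrite addn0.
by rewrite iterSr addnS t_step IH.
Qed.

Lemma t_iter0 n : iter n phi (t n) = iota t0.
Proof. by have := t_iter n 0; rewrite add0n t_0. Qed.

Lemma t_ge0 n : vge v 0 (t n).
Proof. by elim: n => [|n IH]; [rewrite t_0 | apply: phi_ge0_inv; rewrite t_step]. Qed.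

Lemma t_conj_size n P R : is_conjugates iota (t n) P R -> (size R <= q ^ n)%N.
Proof.
move=> tPR; have /andP[sz_gt1 sz_le] := fiter_size n.
have szc : size (fiter n - t0%:P) = size (fiter n).
  by rewrite size_polyDl // size_polyN (leq_ltn_trans (size_polyC_leq1 _)).
have : P %| fiter n - t0%:P.
  apply: (irreducible_root_dvdp (conj_irr tPR) (conj_root tPR (conj_mem tPR))).
  rewrite rmorphB /= map_polyC rootE hornerD hornerN hornerC fiterE.
  by rewrite t_iter0 subrr.
move/dvdp_leq; rewrite -size_poly_gt0 szc (ltn_trans _ sz_gt1) // => /(_ isT).
by rewrite (conj_size tPR) => h; rewrite -ltnS; apply: leq_trans h sz_le.
Qed.

Lemma periodic_iter m : vge v 1 (iota (t0 ^+ (p ^ (k.+1 * m)) - t0)).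
Proof.
elim: m => [|m IH]; first by rewrite muln0 expn0 expr1 subrr rmorph0 vge0.
rewrite rmorphB.
apply: (vge_subtrans vP) (_ : vge v 1 (iota (t0 ^+ (p ^ k.+1)) - iota t0)).
  rewrite mulnS expnD mulnC exprM !rmorphXn.
  apply: (vge_sub_exp vP) => //; first by rewrite vgeX0.
  by rewrite -rmorphXn -rmorphB.
by rewrite -rmorphB.
Qed.

(* An element of K with the same residue as t n. *)
Definition lift n : K := t0 ^+ (p ^ (k * (a * n))).

Definition gap n : L := t n - iota (lift n).

Lemma lift_ge0 n : vge v 0 (iota (lift n)).
Proof. by rewrite rmorphXn vgeX0. Qed.

(** On the residue of t0 the p-th power map has period k + 1, so raising to the power p^k inverts
    it. Hence [lift n], like [t n], has a q^n-th power congruent to t0. *)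
Lemma gap_expr n : vge v 1 (gap n ^+ (q ^ n)).
Proof.
rewrite qX; apply: (vge_sub_frob vP p_pr vp1); rewrite ?t_ge0 ?lift_ge0 // -qX.
apply: (vge_subtrans vP) (_ : vge v 1 (iter n phi (t n) - _)).
  by rewrite vge_subC // iter_cong // t_ge0.
rewrite t_iter0 vge_subC // -rmorphXn -rmorphB -exprM.
by rewrite qX -expnD addnC -mulSn periodic_iter.
Qed.

Lemma lift_step n :
  lift n.+1 ^+ q = (t0 ^+ (p ^ (k.+1 * a))) ^+ (p ^ (k * (a * n))).
Proof.
have E : (k * (a * n.+1) + a = k.+1 * a + k * (a * n))%N.
  by rewrite mulSn !mulnS mulnDr; lia.
by rewrite -!exprM -!expnD E.
Qed.

(** The q-th power map is additive modulo p, and it sends [t n.+1] to [t n] and [lift n.+1] to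
    [lift n] up to valuation 1. *)
Lemma gap_step n : vge v 1 (gap n.+1 ^+ q - gap n).
Proof.
have t1 := t_ge0 n.+1; have l1 := lift_ge0 n.+1.
apply: (vge_subtrans vP) (_ : vge v 1 (t n.+1 ^+ q - iota (lift n.+1) ^+ q - _)).
  by rewrite vge_subC //; apply: (vge_frob_sub vP p_pr vp1).
have -> : t n.+1 ^+ q - iota (lift n.+1) ^+ q - gap n =
   (t n.+1 ^+ q - t n) - (iota (lift n.+1) ^+ q - iota (lift n)).
  by rewrite /gap; ring.
apply: (vgeB vP); first by rewrite -(t_step n) vge_subC // phi_cong.
rewrite -rmorphXn lift_step /lift; move: (p ^ (k * (a * n)))%N => M.
have := periodic_iter a; rewrite rmorphB; move: (p ^ (k.+1 * a))%N => N tN.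
rewrite ![iota (_ ^+ M)]rmorphXn; apply: (vge_sub_exp vP) => //.
by rewrite rmorphXn vgeX0.
Qed.

(** Applying f^s to [t (n + s)] and to [lift (n + s)] gives, by contraction, an element of [K]
    within s of [t n]. It is equally close to every conjugate of [t n]; as s is arbitrary, all
    conjugates coincide, and separability makes the degree 1. *)
Lemma rational_of_small_gaps : (forall n, vge v 1 (gap n)) ->
  forall n, exists c, t n = iota c.
Proof.
move=> small n; have [P [R tPR]] := conjugates_exist K_char0 (t_alg n).
have all_t r : r \in R -> r = t n.
  move=> Rr; apply/eqP; rewrite -subr_eq0; apply/eqP; apply: (vge_eq0 vP) => s.
  pose c := (fiter s).[lift (n + s)].
  have cE : iota c = iter s phi (iota (lift (n + s))).
    by rewrite -fiterE horner_map.
  have tc : vge v s%:R (t n - iota c).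
    rewrite cE -(t_iter s n).
    apply: vge_trans (iter_contract s (t_ge0 _) (lift_ge0 _) (small _)).
    by rewrite lerDr ler01.
  apply: (vge_subtrans vP) (_ : vge v _ (r - iota c)) _; last by rewrite vge_subC.
  have := conj_vge vP K_complete tPR (conj_mem tPR) Rr (h := 'X - c%:P) (c := s%:R).
  by rewrite rmorphB /= map_polyX map_polyC !hornerD !hornerN !hornerX !hornerC; apply.
have RE : R = [:: t n].
  have := conj_uniq tPR; have := conj_mem tPR.
  case: (R) all_t => [|r [|r' R']] // all_t _ /=.
    by rewrite (all_t r) ?mem_head.
  have Er := all_t r (mem_head _ _).
  have Er' : r' = t n by apply: all_t; rewrite !inE eqxx orbT.
  by rewrite Er Er' mem_head.
exists (- P`_0); rewrite rmorphN -coef_map (conj_prod tPR) RE big_seq1.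
by rewrite coefB coefX coefC sub0r opprK.
Qed.

(** * A gap of valuation less than 1 *)

Section LargeGap.

Variable n0 : nat.
Hypothesis gap_n0 : ~~ vge v 1 (gap n0).

Lemma gap_n0_neq0 : gap n0 != 0.
Proof. by apply: contraNneq gap_n0 => ->; rewrite vge0. Qed.

Lemma gap_n0_itv : 0 < vval v (gap n0) < 1.
Proof.
have nz0 := gap_n0_neq0.
have -> : vval v (gap n0) < 1 by rewrite ltNge -vgeE.
rewrite andbT.
have := gap_expr n0; rewrite vgeE ?expf_neq0 // vvalX // => h.
by move: (lt_le_trans ltr01 h); rewrite pmulr_rgt0 // ltr0n expn_gt0 q_gt0.
Qed.

(** The valuation stays below 1, the precision of [gap_step], so the q-th power of each gap has
    exactly the valuation of the preceding gap. *)
Lemma gap_neq0_val m : gap (n0 + m) != 0 /\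
  vval v (gap (n0 + m)) = vval v (gap n0) / (q ^ m)%:R.
Proof.
have /andP[gt0 lt1] := gap_n0_itv.
elim: m => [|m [nz_m vm]]; first by rewrite addn0 expn0 divr1 gap_n0_neq0.
have q_neq0 : q%:R != 0 :> rat by rewrite pnatr_eq0 -lt0n.
have qm1 : 1 <= (q ^ m)%:R :> rat by rewrite ler1n expn_gt0 q_gt0.
have [] := vval_close vP nz_m (gap_step (n0 + m)).
  rewrite vm ltr_pdivrMr; last exact: lt_le_trans ltr01 qm1.
  by rewrite mul1r; apply: lt_le_trans lt1 qm1.
rewrite addnS expf_eq0 q_gt0 /= => nz_S; rewrite vvalX // vm => vS; split=> //.
apply: (mulfI q_neq0); rewrite vS expnS natrM invfM mulrCA mulVKf //.
Qed.

(** Half of the closeness that [iter_fibre_close] gives over [n0] levels. *)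
Let eps : rat := (2 * (q ^ n0)%:R)^-1.

(* Let x be the gap of level n + n0, and let c and b be the traces from level *)
(* n + n0 to level n of y and of y x. Conjugates over level n being           *)
(* congruent modulo 2 eps, so are b and x c. If v c < eps, then it follows    *)
(* that v x = v b - v c, which is impossible since v x is less than 1 over    *)
(* the degree of level n.                                                     *)
Lemma partial_trace_ge m P R P' R' (y u : {poly K}) : (0 < m)%N ->
  is_conjugates iota (t (n0 + m)) P R ->
  is_conjugates iota (t (n0 + m + n0)) P' R' ->
  vge v 0 (map_poly iota y).[t (n0 + m + n0)] ->
  (forall s, s \in R -> (map_poly iota u).[s] =
     \sum_(r <- R' | (map_poly iota (fiter n0)).[r] == s) (map_poly iota y).[r]) ->
  vge v eps (map_poly iota u).[t (n0 + m)].
Proof.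
move=> m_gt0; set n := (n0 + m)%N; set N := (n + n0)%N => tPR tPR' y0 uE.
have fN : (map_poly iota (fiter n0)).[t N] = t n by rewrite fiterE t_iter.
have [_ _ [w wE]] := conj_partial_sum (y * ('X - (lift N)%:P)) tPR tPR' fN.
have tR := conj_mem tPR.
have q0_gt0 : 0 < (q ^ n0)%:R :> rat by rewrite ltr0n expn_gt0 q_gt0.
have eps2 : eps + eps = (q ^ n0)%:R^-1.
  by rewrite /eps invfM -mulrDl -div1r -splitr mul1r.
have eps_gt0 : 0 < eps by rewrite invr_gt0; lra.
have [nzx vx] : gap N != 0 /\ vval v (gap N) = vval v (gap n0) / (q ^ (m + n0))%:R.
  by rewrite /N /n -addnA; apply: gap_neq0_val.
have /andP[g_gt0 g_lt1] := gap_n0_itv.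
have vx_gt0 : 0 < vval v (gap N) by rewrite vx divr_gt0 // ltr0n expn_gt0 q_gt0.
have vx_small : vval v (gap N) < eps.
  rewrite vx /eps addnC expnD natrM ltr_pdivrMr; last first.
    by rewrite mulr_gt0 // ltr0n expn_gt0 q_gt0.
  rewrite invfM mulrA -[2^-1 / _ * _]mulrA mulVf ?gt_eqF // mulr1.
  have : 2 <= (q ^ m)%:R :> rat.
    by rewrite ler_nat; apply: leq_trans q_gt1 _; rewrite -{1}(expn1 q) leq_exp2l.
  lra.
apply: contrapT => /negP not_eps.
set c := (map_poly iota u).[t n] in not_eps.
have nzc : c != 0 by apply: contraNneq not_eps => ->; rewrite vge0.
have vc : vval v c < eps by rewrite ltNge -vgeE.
pose b := (map_poly iota w).[t n].
(* The difference is the sum of y(r) (r - t N) over the conjugates r of [t N] above [t n]. *)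
have close : vge v (eps + eps) (b - c * gap N).
  rewrite /b /c wE // uE // mulr_suml -sumrB eps2.
  rewrite big_seq_cond; apply: vge_sum => // r /andP[R'r /eqP fr].
  rewrite rmorphM hornerM -mulrBr rmorphB /= map_polyX map_polyC !hornerE.
  rewrite /gap opprB addrA subrK.
  have yr : vge v 0 (map_poly iota y).[r].
    exact: (conj_vge vP K_complete tPR' (conj_mem tPR') R'r y0).
  apply: (vgeM0 vP) yr _; apply: iter_fibre_close; last 1 first.
  - by rewrite -!fiterE fr fN.
  - have := conj_vge vP K_complete tPR' (conj_mem tPR') R'r (h := 'X) (c := 0).
    by rewrite map_polyX !hornerX; apply; apply: t_ge0.
  - exact: t_ge0.
have [] := vval_close vP _ close; rewrite ?mulf_neq0 ?vvalM //; first lra.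
move=> nzb vb.
have /intrP[i Ei] := conj_vval_int vP K_complete tPR val_int nzb.
have /intrP[l El] := conj_vval_int vP K_complete tPR val_int nzc.
have sz : (size R)%:R <= (q ^ n)%:R :> rat by rewrite ler_nat (t_conj_size tPR).
have sz0 : 0 < (size R)%:R :> rat by rewrite ltr0n (conj_size_gt0 tPR).
(* This integer is positive, yet at most q^n v(gap N) = v(gap n0) < 1. *)
have E : (i - l)%:~R = (size R)%:R * vval v (gap N).
  rewrite rmorphB /= -Ei -El -/b -/c vb; ring.
have pos : 0 < (i - l)%:~R :> rat by rewrite E mulr_gt0.
have : (i - l)%:~R < 1 :> rat.
  rewrite E; apply: le_lt_trans (_ : (q ^ n)%:R * vval v (gap N) < 1).
    by rewrite ler_pM2r.
  rewrite vx /n addnC mulrCA divff ?mulr1 //.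
  by rewrite pnatr_eq0 -lt0n expn_gt0 q_gt0.
by rewrite ltrz1 => lt1; move: pos; rewrite ltr0z gtz0_ge1 leNgt lt1.
Qed.

(** The offset [n0.+1] makes [mu] at most [eps], and every [level i] has the form n0 + m with m > 0,
    as [partial_trace_ge] requires. *)
Let n1 := (n0 + n0.+1)%N.
Let level i := (n1 + i * n0)%N.
Let mu := vval v (gap n1).

Lemma mu_gt0 : 0 < mu.
Proof.
rewrite /mu; have [_ ->] := gap_neq0_val n0.+1; have /andP[g_gt0 _] := gap_n0_itv.
by rewrite divr_gt0 // ltr0n expn_gt0 q_gt0.
Qed.

Lemma mu_le : mu <= eps.
Proof.
rewrite /mu; have [_ ->] := gap_neq0_val n0.+1; have /andP[_ g_lt1] := gap_n0_itv.
have qn_gt0 : 0 < (q ^ n0)%:R :> rat by rewrite ltr0n expn_gt0 q_gt0.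
have q2 : 2 <= q%:R :> rat by rewrite ler_nat.
rewrite expnS natrM ler_pdivrMr /eps; last by rewrite mulr_gt0 //; lra.
rewrite invfM mulrACA mulVf ?gt_eqF // mulr1; lra.
Qed.

(** It writes [gap n1], an element of the lowest level, in terms of the generator of [level i]. *)
Definition gap_poly i : {poly K} := fiter (i * n0) - (lift n1)%:P.

Lemma gap_polyE i : (map_poly iota (gap_poly i)).[t (level i)] = gap n1.
Proof.
rewrite rmorphB /= map_polyC hornerD hornerN hornerC fiterE t_iter.
by [].
Qed.

(** From level i + 1, multiplication by the (i + 1)-st power of [gap n1] makes y integral. This
    power lies in the lower level, so it comes out of the relative trace, and the product has
    valuation at least [eps >= mu]. The relative trace thus has valuation at least -i mu, and the
    induction hypothesis applies. *)
Lemma trace_ge0 i P R (y : {poly K}) : is_conjugates iota (t (level i)) P R ->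
  vge v (- (i%:R * mu)) (map_poly iota y).[t (level i)] ->
  vge v 0 (\sum_(r <- R) (map_poly iota y).[r]).
Proof.
elim: i P R y => [|i IH] P' R' y tPR' y_ge.
  rewrite mul0r oppr0 in y_ge; rewrite big_seq; apply: vge_sum => // r R'r.
  exact: (conj_vge vP K_complete tPR' (conj_mem tPR') R'r y_ge).
have levelS : level i.+1 = (level i + n0)%N by rewrite /level mulSn; lia.
have levelE : level i = (n0 + (n0.+1 + i * n0))%N by rewrite /level /n1; lia.
have [P [R tPR]] := conjugates_exist K_char0 (t_alg (level i)).
rewrite levelS in tPR' y_ge.
have fN : (map_poly iota (fiter n0)).[t (level i + n0)] = t (level i).
  by rewrite fiterE t_iter.
have [inR sumE [u uE]] := conj_partial_sum y tPR tPR' fN.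
pose W := gap_poly i ^+ i.+1.
have WE : (map_poly iota W).[t (level i)] = gap n1 ^+ i.+1.
  by rewrite rmorphXn horner_exp gap_polyE.
have -> : \sum_(r <- R') (map_poly iota y).[r] = \sum_(s <- R) (map_poly iota u).[s].
  transitivity (\sum_(r <- R') (map_poly iota y).[r] *
      (map_poly iota 1).[(map_poly iota (fiter n0)).[r]]).
    by apply: eq_bigr => r _; rewrite rmorph1 hornerC mulr1.
  rewrite sumE big_seq [RHS]big_seq; apply: eq_bigr => s Rs.
  by rewrite rmorph1 hornerC mulr1 uE.
apply: (IH P) => //.
have [nz_gap _] := gap_neq0_val n0.+1; rewrite -/n1 in nz_gap.
have vgap : vge v (i.+1%:R * mu) (gap n1 ^+ i.+1).
  by apply: vgeX => //; rewrite vgeE.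
have : vge v eps (map_poly iota (u * W)).[t (level i)].
  rewrite levelE; apply: (@partial_trace_ge (n0.+1 + i * n0) P R P' R'
    (y * (W \Po fiter n0))); rewrite -?levelE //.
    rewrite rmorphM hornerM map_comp_horner fN WE.
    by rewrite -(addNr (i.+1%:R * mu)) vgeM.
  move=> s Rs; rewrite rmorphM hornerM uE // mulr_suml.
  apply: eq_bigr => r /eqP fr.
  by rewrite rmorphM hornerM map_comp_horner fr.
rewrite rmorphM hornerM WE.
have [->|nz_u] := eqVneq (map_poly iota u).[t (level i)] 0; first by rewrite vge0.
rewrite !vgeE ?mulf_neq0 ?expf_neq0 // vvalM ?expf_neq0 // vvalX // -/mu.
have := mu_le; rewrite -nat1r; lra.
Qed.

(** By [trace_ge0] the inverse of the i-th power of [gap n1] lies in the codifferent at [level i];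
    [i] is taken larger than B / mu. *)
Lemma deeply_ramified_of_large_gap :
  deeply_ramified iota v (\bigcup_n adjoin iota (t n)).
Proof.
move=> B; pose i := Num.bound `|B / mu|.
have [P [R tPR]] := conjugates_exist K_char0 (t_alg (level i)).
have [F [j [tau [jE j_tau dimF genF]]]] := simple_extension_exists tPR.
pose w := (map_poly (in_alg F) (gap_poly i)).[tau].
have jw : j w = gap n1 by rewrite (j_horner jE j_tau) gap_polyE.
have [nz_gap _] := gap_neq0_val n0.+1; rewrite -/n1 in nz_gap.
have nz_w : w != 0 by rewrite -(fmorph_eq0 j) jw.
pose z := (w ^+ i)^-1.
have nz_z : z != 0 by rewrite invr_eq0 expf_neq0.
have vz : vval v (j z) = - (i%:R * mu).
  by rewrite fmorphV rmorphXn jw vvalV ?expf_neq0 // vvalX.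
have zC : codifferent (v \o j) z.
  apply/(codifferentP v jE) => y y0; have [h Eh] := genF (z * y).
  have [tE _] := trace_norm_conjugates tPR jE j_tau dimF genF h.
  rewrite Eh tE; apply: trace_ge0 tPR _.
  rewrite -(j_horner jE j_tau) -Eh rmorphM -[- _]addr0; apply: vgeM => //.
  by rewrite vgeE ?fmorph_eq0 // vz.
have [d dD le_d] := different_valuation_exists vP K_complete K_char0 val_int
  val_surj tPR jE j_tau dimF genF nz_z zC.
exists F, j, d; split=> //.
  move=> _ [x _ <-]; have [h ->] := genF x.
  exists (level i) => //; exists h, 1; rewrite rmorph1 hornerC oner_neq0 divr1.
  by rewrite (j_horner jE j_tau).
apply: lt_le_trans le_d; rewrite vz opprK -ltr_pdivrMr ?mu_gt0 //.
exact: le_lt_trans (ler_norm _) (archi_boundP (normr_ge0 _)).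
Qed.

End LargeGap.

End Iteration.

Theorem corollary5p3 (p : nat) (p_prime : prime p)
  (Qp : fieldType) (vp : Qp -> \bar rat) (Qp_padic : is_padic_field p vp)
  (K : fieldExtType Qp)
  (Kbar : closedFieldType) (iota : {rmorphism K -> Kbar})
  (Kbar_closure : is_algebraic_closure iota)
  (vK : Kbar -> \bar rat) (vK_norm : is_normalized_valuation vp iota vK)
  (f : {poly K}) (f_int : f \is a polyOver (val_ring (vK \o iota)))
  (f_monic : f \is monic) (f_deg : (2 <= (size f).-1)%N)
  (a : nat) (a_ge1 : (1 <= a)%N)
  (f_cong : forall i : nat, (f - 'X^(p ^ a))`_i \in val_max (vK \o iota))
  (t0 : K) (t0_int : t0 \in val_ring (vK \o iota))
  (t : nat -> Kbar) (t_0 : t 0%N = iota t0)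
  (t_step : forall n : nat, (map_poly iota f).[t n.+1] = t n) :
  let Kinf : set Kbar := \bigcup_n adjoin iota (t n) in
  Kinf = range iota \/ deeply_ramified iota vK Kinf.
Proof.
have vP := normalized_valuation vK_norm.
have K_char0 := ext_char0 Qp_padic K.
have K_complete := ext_complete Qp_padic vK_norm.
have vp1 := ext_vge_p p_prime Qp_padic vK_norm.
have f_cong1 i : vge vK 1 (iota (f - 'X^(p ^ a))`_i).
  by apply: (ext_pos_ge1 vK_norm); have := f_cong i.
(* In a degree above p^a, the leading coefficient 1 would lie in the maximal ideal. *)
have f_deg_le : (2 <= (size f).-1 <= p ^ a)%N.
  rewrite f_deg leqNgt; apply/negP => lt_q.
  have := f_cong (size f).-1; rewrite coefB coefXn gtn_eqF // subr0.
  rewrite -lead_coefE (monicP f_monic) inE /= rmorph1.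
  by rewrite (valE vP (oner_neq0 _)) vval1 // ltxx.
(* The period is positive and is written [k.+1], so that the power p^k inverts Frobenius on the
   residue of t0. *)
have [[|k] // _ t0_periodic] :=
  ext_frobenius_periodic p_prime Qp_padic vK_norm t0_int.
have t_alg n : algebraicOver iota (t n) by [].
have val_int := ext_val_int vK_norm; have val_surj := ext_val_surj vK_norm.
move=> Kinf.
have [small|/existsNP[n0 /negP gap_n0]] :=
  pselect (forall n, vge vK 1 (gap iota p a t0 t k n)); [left | right].
  have t_K := rational_of_small_gaps vP K_complete K_char0 p_prime vp1 f_monic
    f_deg_le f_cong1 t0_int t_0 t_step t_alg small.
  apply/seteqP; split=> [x [n _ [g [h [nz_h ->]]]] | _ [c _ <-]].
    have [c ->] := t_K n; exists (g.[c] / h.[c]) => //.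
    by rewrite fmorph_div !horner_map.
  exists 0%N => //; exists c%:P, 1%:P; rewrite !map_polyC !hornerC /= rmorph1.
  by rewrite oner_neq0 divr1.
exact: (deeply_ramified_of_large_gap vP K_complete K_char0 val_int val_surj
  p_prime vp1 f_monic f_deg_le f_cong1 t0_int t0_periodic t_0 t_step t_alg gap_n0).
Qed.
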